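(* Assume that $\varphi\in L^1(\nu)$ and that $\frac{f}{\varphi}\in L^1(\nu)$ for all $f\in Z$. Then the bilinear form $(\mathscr{D},Z)$ defined by $$\mathscr{D}(f,g):=\frac12\int\langle Df,Dg\rangle_{\mathbb{H}}\,\varphi\,d\nu,\qquad f,g\in Z,$$ is closable on $L^2(\varphi\nu)$. Moreover, $(D,Z)$ is closable as an operator $L^2(\varphi\nu)\supset Z\to L^2(\varphi\nu;\mathbb{H})$.
   Context: Let $d\in\mathbb{N}$, $\Omega:=\{\gamma\in C([0,1];\mathbb{R}^d):\gamma(0)=0\}$, and let $\nu$ be the Wiener measure on $\Omega$. Let $\mathbb{H}$ be the Cameron--Martin space of absolutely continuous $f:[0,1]\to\mathbb{R}^d$ with $f(0)=0$ and $f'\in L^2([0,1];\mathbb{R}^d)$, with inner product $\langle f,g\rangle_{\mathbb{H}}=\int_0^1\langle f'(x),g'(x)\rangle_{\mathbb{R}^d}\,dx$. The weight $\varphi:\Omega\to[0,\infty]$ is measurable, and $\varphi\nu$ denotes the measure with density $\varphi$ with respect to $\nu$. Let $Z$ be the set of cylindrical functions $F(\gamma)=f(\gamma(s_1),\dots,\gamma(s_k))$, $k\in\mathbb{N}$, $0<s_1<\dots<s_k=1$, $f\in C_p^\infty((\mathbb{R}^d)^k)$, where $C^\infty_p$ means smooth with $f$ and all its partial derivatives of polynomial growth. For such $F$ the gradient $DF(\gamma)\in\mathbb{H}$ is $D_sF(\gamma)=\sum_{i=1}^k (s_i\wedge s)\,(\nabla_{s_i}f)(\gamma(s_1),\dots,\gamma(s_k))$,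 $s\in[0,1]$, where $\nabla_{s_i}f$ is the gradient of $f$ in its $i$th variable. *)

(* Defs.v *)
From HB Require Import structures.
From mathcomp Require Import all_boot all_order all_algebra.
From mathcomp Require Import all_classical all_reals all_analysis.
From mathcomp Require Import measurable_realfun.
Import Order.TTheory GRing.Theory Num.Theory.
Import numFieldNormedType.Exports.

Set Implicit Arguments.
Unset Strict Implicit.
Unset Printing Implicit Defensive.

Local Open Scope classical_set_scope.
Local Open Scope ring_scope.

Section path_space.
Context (R : realType) (d : nat).

Definition unit_interval : Type := set_type (`[0, 1]%classic : set R).

Fact mem0_unit_interval : (0 : R) \in (`[0, 1]%classic : set R).
Proof. by rewrite inE /= in_itv /= lexx ler01. Qed.

Definition time0 : unit_interval := exist _ 0 mem0_unit_interval.

Definition based_paths : set (continuousType unit_interval 'rV[R]_d) :=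
  [set g | g time0 = 0].

Definition pathT : Type := set_type based_paths.
HB.instance Definition _ := Choice.on pathT.

Definition path_at (g : pathT) (t : unit_interval) : 'rV[R]_d :=
  (set_val g : continuousType unit_interval 'rV[R]_d) t.

Definition zero_fun : continuousType unit_interval 'rV[R]_d :=
  mkcts (@cst_continuous unit_interval 'rV[R]_d 0).

Fact zero_fun_based : zero_fun \in based_paths.
Proof. by rewrite inE. Qed.

HB.instance Definition _ := isPointed.Build pathT
  (exist (fun g => g \in based_paths) zero_fun zero_fun_based).

(* Generates the Borel sigma-algebra of the topology of uniform convergence. *)
Definition coordinate_events : set (set pathT) :=
  [set A | exists t : unit_interval, exists l : 'I_d, exists2 B : set R,
     measurable B & A = [set g | B (path_at g t ord0 l)]].

Definition Omega := g_sigma_algebraType coordinate_events.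

HB.instance Definition _ := Measurable.on Omega.

(* For every grid t_0 < ... < t_n in [0, 1], the n * d scalar increments over
   the grid are independent centred Gaussians of variance t_(j+1) - t_j (the
   second argument of normal_prob is the standard deviation). *)
Definition is_wiener (nu : probability Omega R) : Prop :=
  forall (n : nat) (t : 'I_n.+1 -> unit_interval),
    (forall i j : 'I_n.+1, (i < j)%N -> set_val (t i) < set_val (t j) :> R) ->
  let t0 (j : 'I_n) := t (widen_ord (leqnSn n) j) in
  let t1 (j : 'I_n) := t (lift ord0 j) in
  forall B : 'I_n -> 'I_d -> set R, (forall j l, measurable (B j l)) ->
  nu [set g | forall j l,
        B j l (path_at g (t1 j) ord0 l - path_at g (t0 j) ord0 l)] =
  (\prod_(j < n) \prod_(l < d)
     normal_prob 0 (Num.sqrt (set_val (t1 j) - set_val (t0 j))) (B j l))%E.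

End path_space.

Section cameron_martin.
Context (R : realType) (d : nat).
Local Notation mu := (@lebesgue_measure R).
Local Notation I01 := (`[0, 1]%classic : set R).
Implicit Types f g : R -> 'rV[R]_d.

(* Functions [0, 1] -> R^d are represented by functions on R of which only the
   values on [0, 1] are relevant. *)

Definition abs_continuous01 f : Prop :=
  forall e : R, 0 < e -> exists2 delta : R, 0 < delta &
    forall (n : nat) (a b : 'I_n -> R),
      (forall i, 0 <= a i /\ a i <= b i /\ b i <= 1) ->
      trivIset setT (fun i => `]a i, b i[%classic : set R) ->
      \sum_(i < n) (b i - a i) < delta ->
      \sum_(i < n) `|f (b i) - f (a i)| < e.

(* That f is differentiable a.e. already follows from absolute continuity. *)
Definition cameron_martin : set (R -> 'rV[R]_d) :=
  [set f | [/\ abs_continuous01 f,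
               f 0 = 0,
               {ae mu, forall x, I01 x -> derivable f x 1},
               (forall l, measurable_fun I01 (fun x => derive1 f x ord0 l)) &
               (\int[mu]_(x in I01)
                  (\sum_(l < d) (derive1 f x ord0 l) ^+ 2)%:E < +oo)%E]].

Definition Hdot f g : R :=
  \int[mu]_(x in I01) \sum_(l < d) derive1 f x ord0 l * derive1 g x ord0 l.

Definition Hnorm f : R := Num.sqrt (Hdot f f).

(* Relatively open in cameron_martin; H is separable, so measurability with
   respect to these sets is strong measurability. *)
Definition Hopen (U : set (R -> 'rV[R]_d)) : Prop :=
  forall f, cameron_martin f -> U f -> exists2 r : R, 0 < r &
    forall g, cameron_martin g -> Hnorm (g - f) < r -> U g.

End cameron_martin.

Section cylindrical_representations.
Context (R : realType) (d : nat).

(* f : (R^d)^m -> R; row i of the matrix argument is the i-th variable. *)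
Definition partials m (s : seq ('I_m * 'I_d)) (f : 'M[R]_(m, d) -> R) :
    'M[R]_(m, d) -> R :=
  foldr (fun p g x => 'D_(delta_mx p.1 p.2) g x) f s.

Definition smooth_poly_growth m (f : 'M[R]_(m, d) -> R) : Prop :=
  forall s : seq ('I_m * 'I_d),
    (forall x, differentiable (partials s f) x) /\
    exists (C : R) (N : nat), forall x, `|partials s f x| <= C * (1 + `|x|) ^+ N.

Record cyl_rep := CylRep {
  cyl_size : nat ;
  cyl_times : 'I_cyl_size.+1 -> unit_interval R ;
  cyl_base : 'M[R]_(cyl_size.+1, d) -> R ;
  cyl_times_gt0 : forall i, 0 < set_val (cyl_times i) :> R ;
  cyl_times_lt : forall i j : 'I_cyl_size.+1, (i < j)%N ->
    set_val (cyl_times i) < set_val (cyl_times j) :> R ;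
  cyl_times_last : set_val (cyl_times ord_max) = 1 :> R ;
  cyl_base_smooth : smooth_poly_growth cyl_base }.

End cylindrical_representations.

Arguments cyl_times {R d} c i.
Arguments cyl_base {R d} c x.
Arguments cyl_base_smooth {R d} c s.

Section cylindrical_functions.
Context (R : realType) (d : nat).
Local Notation cyl_rep := (cyl_rep R d).

Definition cyl_sample (c : cyl_rep) (g : Omega R d) :
    'M[R]_((cyl_size c).+1, d) :=
  \matrix_(i, l) path_at g (cyl_times c i) ord0 l.

Definition cyl_fun (c : cyl_rep) (g : Omega R d) : R :=
  cyl_base c (cyl_sample c g).

Definition cyl_grad (c : cyl_rep) (g : Omega R d) : R -> 'rV[R]_d :=
  fun s => \row_l \sum_(i < (cyl_size c).+1)
    Num.min (set_val (cyl_times c i)) s *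
    'D_(delta_mx i l) (cyl_base c) (cyl_sample c g).

Definition cylZ : set (Omega R d -> R) := range cyl_fun.

(* The choice of a representation is immaterial on [0, 1], see gradE below. *)
Definition grad (F : Omega R d -> R) : Omega R d -> R -> 'rV[R]_d :=
  if pselect (exists c, cyl_fun c = F) is left ex
  then cyl_grad (projT1 (cid ex)) else fun _ _ => 0.

End cylindrical_functions.

(* e |-> g + e *: (min(., s) e_l) is a Cameron-Martin shift; the derivative of
   F along it depends on F only and recovers the l-th coordinate of D_s F. *)
Section gradE.
Context (R : realType) (d : nat).
Variables (g : Omega R d) (s : R) (l : 'I_d).
Hypothesis s0 : 0 <= s.

Definition shift_fun (e : R) (t : unit_interval R) : 'rV[R]_d :=
  path_at g t + (e * Num.min (set_val t) s) *: delta_mx ord0 l.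

Fact shift_fun_continuous e : continuous (shift_fun e).
Proof.
move=> t; have h1 : continuous (path_at g).
  exact: (@cts_fun _ _ (set_val g : continuousType (unit_interval R) 'rV[R]_d)).
have h2 : continuous (fun t : unit_interval R => set_val t : R).
  exact: initial_continuous.
have {}h1 := h1 t; have {}h2 := h2 t.
have FF : Filter (nbhs t) by exact: nbhs_filter.
rewrite /continuous_at /shift_fun in h1 h2 *; move: (nbhs t) FF h1 h2 => F FF h1 h2.
have min2 (x y : R) : Num.min x y = (x + y - `|x - y|) / 2 by exact: minr_absE.
apply: cvgD; first exact: h1.
apply: cvgZr_tmp; apply: cvgM; first exact: cvg_cst.
rewrite min2; under eq_cvg do rewrite min2.
apply: cvgM; last exact: cvg_cst.
apply: cvgB; first by apply: cvgD; [exact: h2|exact: cvg_cst].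
by apply: cvg_norm; apply: cvgB; [exact: h2|exact: cvg_cst].
Qed.

Fact shift_fun_based e :
  (mkcts (@shift_fun_continuous e) : continuousType _ _) \in @based_paths R d.
Proof.
rewrite inE /based_paths /= /mkcts /shift_fun.
have -> : path_at g (time0 R) = 0 by case: g => x gx; exact: (set_mem gx).
have -> : set_val (time0 R) = 0 :> R by [].
by rewrite add0r min_l// mulr0 scale0r.
Qed.

Definition shift_path e : Omega R d :=
  exist (fun g => g \in @based_paths R d) _ (shift_fun_based e).

Lemma cyl_grad_shift (c : cyl_rep R d) :
  cyl_grad c g s ord0 l = derive1 (fun e => cyl_fun c (shift_path e)) 0.
Proof.
have df : differentiable (cyl_base c) (cyl_sample c g) := (cyl_base_smooth c [::]).1 _.
pose M := \matrix_(i < (cyl_size c).+1, k < d)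
  (Num.min (set_val (cyl_times c i)) s * (k == l)%:R).
have ME : M = \sum_i Num.min (set_val (cyl_times c i)) s *: delta_mx i l.
  apply/matrixP => i k; rewrite !mxE summxE (bigD1 i)//= big1 ?addr0 => [|j ji].
    by rewrite !mxE eqxx.
  by rewrite !mxE eq_sym (negbTE ji) mulr0.
have -> : cyl_grad c g s ord0 l = 'D_M (cyl_base c) (cyl_sample c g).
  rewrite mxE deriveE// ME linear_sum; apply: eq_bigr => i _.
  by rewrite linearZ deriveE.
have E e : cyl_fun c (shift_path e) = cyl_base c (e *: M + cyl_sample c g).
  congr cyl_base; apply/matrixP => i k; by rewrite !mxE addrC mulrA.
rewrite derive1E /derive.
set u := (X in lim (X @ _)); set v := (X in _ = lim (X @ _)).
suff -> : u = v by [].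
apply/funext => e; rewrite /u /v /= !E scale0r add0r addr0.
by rewrite (_ : e *: 1 = e)//; exact: mulr1.
Qed.
End gradE.

Lemma gradE (R : realType) (d : nat) (c : cyl_rep R d) g s : 0 <= s ->
  grad (cyl_fun c) g s = cyl_grad c g s.
Proof.
move=> s0; rewrite /grad; case: pselect => [ex|[]]; last by exists c.
case: cid => c' /= E; apply/rowP => l.
by rewrite !(cyl_grad_shift g l s0) E.
Qed.

Section density.
Context d (T : measurableType d) (R : realType).
Variables (nu : {measure set T -> \bar R}) (phi : T -> \bar R).

Definition mdensity (mphi : measurable_fun setT phi)
    (phi0 : forall x, (0 <= phi x)%E) : set T -> \bar R :=
  fun A => (\int[nu]_(x in A) phi x)%E.

Variables (mphi : measurable_fun setT phi) (phi0 : forall x, (0 <= phi x)%E).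

Let mdensity0 : mdensity mphi phi0 set0 = 0%E.
Proof. by rewrite /mdensity integral_set0. Qed.

Let mdensity_ge0 A : (0 <= mdensity mphi phi0 A)%E.
Proof. exact: integral_ge0. Qed.

Let mdensity_sigma_additive : semi_sigma_additive (mdensity mphi phi0).
Proof.
move=> A mA tA mUA; rewrite /mdensity ge0_integral_bigcup//; last first.
  exact: measurable_funTS.
by apply: is_cvg_ereal_nneg_natsum_cond => n _ _; exact: integral_ge0.
Qed.

HB.instance Definition _ := isMeasure.Build _ _ _ (mdensity mphi phi0)
  mdensity0 mdensity_ge0 mdensity_sigma_additive.

End density.

Section closability.
Context d0 (T : measurableType d0) (R : realType) (d : nat).
Variable mu : {measure set T -> \bar R}.
Local Open Scope ereal_scope.

(* Z need not consist of square-integrable functions, hence the extended-valued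
   norms and form; the convergences force F n (and E of the differences) to be
   finite for large indices, and when all elements of Z have finite norm and
   energy this is the usual closability. *)
Definition closable_form (Z : set (T -> R))
    (E : (T -> R) -> (T -> R) -> \bar R) : Prop :=
  forall F : (T -> R)^nat, (forall n, Z (F n)) ->
    'N[mu]_2%:E[EFin \o F n] @[n --> \oo] --> 0 ->
    E (F p.1 \- F p.2)%R (F p.1 \- F p.2)%R @[p --> (\oo, \oo)] --> 0 ->
    E (F n) (F n) @[n --> \oo] --> 0.

Definition L2H_norm (u : T -> R -> 'rV[R]_d) : \bar R :=
  'N[mu]_2%:E[(fun x => (Hnorm (u x))%:E)].

Definition L2H : set (T -> R -> 'rV[R]_d) :=
  [set u | [/\ forall x, cameron_martin (u x),
               forall U, Hopen U -> measurable (u @^-1` U) &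
               L2H_norm u < +oo]].

Definition closable_operator (Z : set (T -> R))
    (D : (T -> R) -> T -> R -> 'rV[R]_d) : Prop :=
  forall (F : (T -> R)^nat) (u : T -> R -> 'rV[R]_d),
    (forall n, Z (F n)) -> L2H u ->
    'N[mu]_2%:E[EFin \o F n] @[n --> \oo] --> 0 ->
    L2H_norm (fun x => D (F n) x - u x)%R @[n --> \oo] --> 0 ->
    L2H_norm u = 0.

End closability.

Section dirichlet_form.
Context (R : realType) (d : nat).
Variable mu : {measure set (Omega R d) -> \bar R}.

Definition dform (F G : Omega R d -> R) : \bar R :=
  (2^-1%:E * \int[mu]_g (Hdot (grad F g) (grad G g))%:E)%E.

End dirichlet_form.

(* Main.v *)
Require Import Defs.
From HB Require Import structures.
From mathcomp Require Import all_boot all_order all_algebra.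
From mathcomp Require Import all_classical all_reals all_analysis.
From mathcomp Require Import measurable_realfun.
From mathcomp Require Import ring lra.
Import Order.TTheory GRing.Theory Num.Theory.
Import numFieldNormedType.Exports.

Set Implicit Arguments.
Unset Strict Implicit.
Unset Printing Implicit Defensive.

Import HBNNSimple.

Local Open Scope classical_set_scope.
Local Open Scope ring_scope.

(** The weight is tamed by its own reciprocal. By the Young inequality
    2 |F K| <= F^2 phi / e + e K^2 / phi, and K^2 / phi is integrable for every
    cylindrical K because K^2 is cylindrical. So convergence F_n -> 0 in
    L^2(phi nu) forces the pairings of F_n with any K in Z, taken with respect to
    the unweighted Wiener measure, to converge to 0 (pairing_cvg0).

    Without the weight, the directional derivative dirD F s l along the
    reproducing element min(., s) e_l can be moved to the other factor:
    the integral of (dirD F s l) G is that of F (G g_l(s) - dirD G s l)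
    (wiener_ibp2), and G g_l(s) - dirD G s l is again cylindrical. This identity
    is reduced to a one-dimensional Gaussian integral: over a grid the increments
    of the path are independent Gaussians and F is a smooth function of them
    (increment_ibp). The pairings of dirD (F_n) s l with cylindrical functions
    thus converge to 0.

    Let moreover the gradients of F_n be Cauchy in L^2(phi nu; H). Along a fast
    subsequence dirD (F_n) s l converges almost everywhere, with an integrable
    majorant, again by Young; the limit annihilates the functions of Z with values
    in [0, 1]. Products of logistic functions of coordinates approximate the
    indicators of a pi-system which generates the sigma-algebra, so the limit
    vanishes almost everywhere
    (cvg_ae_of_fast, dirD_fast_cvg0).

    A gradient DF is a combination, with coefficients depending on the path, of
    reproducing elements, against which the inner product only sees directional
    derivatives. Hence for fixed p the limit inferior of |DF_p - DF_n|^2 along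
    the subsequence is at least |DF_p|^2 almost everywhere, and by Fatou the
    energy of F_p is bounded by the limit of the energies of F_p - F_n, which is
    small for large p. So the energies of F_p tend to 0 (energy_closable), which
    is closability of the form. If DF_n converges to u, the sequence is Cauchy
    and therefore |u|^2 <= 2 |DF_n|^2 + 2 |DF_n - u|^2 tends to 0 in mean
    (gradient_closable).

    In the calculation with gradients their derivatives in time are known
    explicitly off finitely many points, and those of elements of the
    Cameron-Martin space off a null set; everything is expressed through the
    L^2 inner product ip of such almost everywhere derivatives. *)

(** * Smooth functions of polynomial growth *)

Section smooth_calculus.
Context (R : realType) (d : nat).
Implicit Types m n : nat.

Definition poly_growth m (f : 'M[R]_(m, d) -> R) : Prop :=
  exists (C : R) (N : nat), forall x, `|f x| <= C * (1 + `|x|) ^+ N.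

Lemma poly_growth_pos m (f : 'M[R]_(m, d) -> R) : poly_growth f ->
  exists C N, 0 <= C /\ forall x, `|f x| <= C * (1 + `|x|) ^+ N.
Proof.
move=> [C [N fC]]; exists C, N; split=> //.
by have := le_trans (normr_ge0 _) (fC 0); rewrite normr0 addr0 expr1n mulr1.
Qed.

Lemma poly_growthD m (f g : 'M[R]_(m, d) -> R) :
  poly_growth f -> poly_growth g -> poly_growth (fun x => f x + g x).
Proof.
move=> /poly_growth_pos[C [N [C0 fC]]] /poly_growth_pos[D [P [D0 gD]]].
exists (C + D), (N + P)%N => x; apply: (le_trans (ler_normD _ _)).
have x1 : 1 <= 1 + `|x| by rewrite lerDl.
rewrite mulrDl; apply: lerD.
- by apply: (le_trans (fC x)); rewrite ler_wpM2l// ler_weXn2l// leq_addr.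
- by apply: (le_trans (gD x)); rewrite ler_wpM2l// ler_weXn2l// leq_addl.
Qed.

Lemma poly_growthM m (f g : 'M[R]_(m, d) -> R) :
  poly_growth f -> poly_growth g -> poly_growth (fun x => f x * g x).
Proof.
move=> /poly_growth_pos[C [N [C0 fC]]] /poly_growth_pos[D [P [D0 gD]]].
exists (C * D), (N + P)%N => x.
by rewrite normrM exprD mulrACA ler_pM.
Qed.

Lemma poly_growth_cst m (a : R) : poly_growth (fun _ : 'M[R]_(m, d) => a).
Proof. by exists `|a|, 0%N => x; rewrite expr0 mulr1. Qed.

Lemma mx_entry_le m n (x : 'M[R]_(m, n)) i j : `|x i j| <= `|x|.
Proof.
rewrite [leRHS]/Num.norm /= mx_normrE.
by apply/bigmax_geP; right => /=; exists (i, j).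
Qed.

Lemma poly_growth_coord m i l : poly_growth (fun x : 'M[R]_(m, d) => x i l).
Proof.
exists 1, 1%N => x; rewrite mul1r expr1.
by rewrite (le_trans (mx_entry_le x i l))// lerDr.
Qed.

Lemma mulmx_norm_le m n (P : 'M[R]_(n, m)) :
  exists2 c : R, 0 <= c & forall x : 'M[R]_(m, d), `|P *m x| <= c * `|x|.
Proof.
exists (\sum_i \sum_k `|P i k|); first by do 2!apply: sumr_ge0 => ? _.
move=> x; rewrite [leLHS]/Num.norm /= mx_normrE; apply/bigmax_leP; split=> /=.
  by rewrite mulr_ge0//; do 2!apply: sumr_ge0 => ? _.
move=> [i j] _ /=; rewrite mxE (le_trans (ler_norm_sum _ _ _))//.
rewrite (bigD1 i)//= mulrDl ler_wpDr//.
  by rewrite mulr_ge0//; do 2!apply: sumr_ge0 => ? _.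
rewrite mulr_suml ler_sum// => k _.
by rewrite normrM ler_wpM2l// mx_entry_le.
Qed.

Lemma poly_growth_mulmx m n (P : 'M[R]_(n, m)) (f : 'M[R]_(n, d) -> R) :
  poly_growth f -> poly_growth (fun x => f (P *m x)).
Proof.
move=> /poly_growth_pos[C [N [C0 fC]]]; have [c c0 Pc] := mulmx_norm_le P.
exists (C * (1 + c) ^+ N), N => x; apply: (le_trans (fC _)).
rewrite -mulrA ler_wpM2l// -exprMn lerXn2r ?nnegrE ?addr_ge0 ?mulr_ge0 ?addr_ge0//.
rewrite mulrDl mul1r -addrA lerD2l mulrDr mulr1.
by rewrite (le_trans (Pc x))// addrA lerDr addr_ge0.
Qed.

Lemma differentiable_mulmx m n (P : 'M[R]_(n, m)) (x : 'M[R]_(m, d)) :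
  differentiable (mulmx P : 'M[R]_(m, d) -> 'M[R]_(n, d)) x.
Proof.
apply: linear_differentiable; apply: bounded_linear_continuous.
apply/linear_boundedP; have [c c0 Pc] := mulmx_norm_le P.
near=> r => y; apply: (le_trans (Pc y)).
by rewrite ler_wpM2r//; near: r; apply: nbhs_pinfty_ge; rewrite num_real.
Unshelve. all: by end_near. Qed.

Lemma derive_mulmx m n (P : 'M[R]_(n, m)) (f : 'M[R]_(n, d) -> R) x i l :
  differentiable f (P *m x) ->
  'D_(delta_mx i l) (fun x : 'M[R]_(m, d) => f (P *m x)) x =
  \sum_j P j i * 'D_(delta_mx j l) f (P *m x).
Proof.
move=> df; have dP := differentiable_mulmx P x.
rewrite deriveE; last exact: (differentiable_comp dP df).
rewrite (diff_comp dP df) /= diff_lin; last first.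
  by move=> y; apply: differentiable_continuous; exact: differentiable_mulmx.
have E : P *m delta_mx i l = \sum_j P j i *: (delta_mx j l : 'M[R]_(n, d)).
  apply/matrixP => a b; rewrite !mxE summxE (bigD1 i)//= big1 ?addr0; last first.
    by move=> k ki; rewrite mxE (negbTE ki) mulr0.
  rewrite (bigD1 a)//= [X in _ + X]big1 ?addr0; last first.
    by move=> k ka; rewrite !mxE [a == k]eq_sym (negbTE ka) mulr0.
  by rewrite !mxE !eqxx.
rewrite [X in _ X = _]E linear_sum.
by apply: eq_bigr => j _; rewrite linearZ deriveE.
Qed.

Inductive gen_alg m (B : ('M[R]_(m, d) -> R) -> Prop) :
    ('M[R]_(m, d) -> R) -> Prop :=
| gen_base f : B f -> gen_alg B f
| gen_cst a : gen_alg B (fun=> a)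
| gen_add f g : gen_alg B f -> gen_alg B g -> gen_alg B (fun x => f x + g x)
| gen_mul f g : gen_alg B f -> gen_alg B g -> gen_alg B (fun x => f x * g x).

Lemma gen_alg_sum m (B : ('M[R]_(m, d) -> R) -> Prop) (I : Type) (r : seq I)
    (f : I -> 'M[R]_(m, d) -> R) :
  (forall i, gen_alg B (f i)) -> gen_alg B (fun x => \sum_(i <- r) f i x).
Proof.
move=> Bf; elim: r => [|a r IH].
  by under eq_fun do rewrite big_nil; exact: gen_cst.
by under eq_fun do rewrite big_cons; exact: gen_add.
Qed.

(** All closure properties of smooth functions of polynomial growth come from
    this coinduction principle: by the Leibniz rule an algebra is stable under
    partial derivatives as soon as these map its generators into it. *)
Lemma gen_alg_smooth m (B : ('M[R]_(m, d) -> R) -> Prop) :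
  (forall f, B f -> (forall x, differentiable f x) /\ poly_growth f) ->
  (forall f i l, B f -> gen_alg B ('D_(delta_mx i l) f)) ->
  forall f, gen_alg B f -> smooth_poly_growth f.
Proof.
move=> B1 B2.
have H1 f : gen_alg B f -> (forall x, differentiable f x) /\ poly_growth f.
  elim=> {f} [f /B1//|a|f g _ [df gf] _ [dg gg]|f g _ [df gf] _ [dg gg]].
  - by split; [move=> x; exact: differentiable_cst|exact: poly_growth_cst].
  - by split; [move=> x; exact: differentiableD|exact: poly_growthD].
  - by split; [move=> x; exact: differentiableM|exact: poly_growthM].
have H2 f i l : gen_alg B f -> gen_alg B ('D_(delta_mx i l) f).
  elim=> {f} [f /B2//|a|f g Bf IHf Bg IHg|f g Bf IHf Bg IHg].
  - rewrite (_ : 'D__ _ = fun=> 0); first exact: gen_cst.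
    by apply/funext => x; exact: derive_cst.
  - rewrite (_ : 'D__ _ = fun x => 'D_(delta_mx i l) f x + 'D_(delta_mx i l) g x).
      exact: gen_add.
    apply/funext => x; apply: deriveD; apply: diff_derivable.
    + exact: (H1 _ Bf).1.
    + exact: (H1 _ Bg).1.
  - rewrite (_ : 'D__ _ = fun x =>
      f x * 'D_(delta_mx i l) g x + g x * 'D_(delta_mx i l) f x).
      by apply: gen_add; exact: gen_mul.
    apply/funext => x; apply: deriveM; apply: diff_derivable.
    + exact: (H1 _ Bf).1.
    + exact: (H1 _ Bg).1.
have H3 (s : seq ('I_m * 'I_d)) f : gen_alg B f -> gen_alg B (partials s f).
  by elim/last_ind: s f => // s [i l] IH f Bf; rewrite /partials foldr_rcons; exact/IH/H2.
by move=> f Bf s; exact/H1/H3.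
Qed.

Lemma smooth_derive m (f : 'M[R]_(m, d) -> R) i l :
  smooth_poly_growth f -> smooth_poly_growth ('D_(delta_mx i l) f).
Proof. by move=> sf s; have := sf (rcons s (i, l)); rewrite /partials foldr_rcons. Qed.

Lemma smooth_differentiable m (f : 'M[R]_(m, d) -> R) x :
  smooth_poly_growth f -> differentiable f x.
Proof. by move=> sf; exact: (sf [::]).1. Qed.

Lemma smooth_gen_alg m (f : 'M[R]_(m, d) -> R) :
  gen_alg (@smooth_poly_growth R d m) f -> smooth_poly_growth f.
Proof.
apply: gen_alg_smooth => [g sg|g i l sg]; first exact: (sg [::]).
by apply: gen_base; exact: smooth_derive.
Qed.

Lemma smooth_cst m a : smooth_poly_growth (fun _ : 'M[R]_(m, d) => a).
Proof. by apply: smooth_gen_alg; exact: gen_cst. Qed.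

Lemma smoothM m (f g : 'M[R]_(m, d) -> R) : smooth_poly_growth f ->
  smooth_poly_growth g -> smooth_poly_growth (fun x => f x * g x).
Proof. by move=> sf sg; apply: smooth_gen_alg; apply: gen_mul; exact: gen_base. Qed.

Lemma smooth_sum m n (f : 'I_n -> 'M[R]_(m, d) -> R) :
  (forall i, smooth_poly_growth (f i)) ->
  smooth_poly_growth (fun x => \sum_i f i x).
Proof.
by move=> sf; apply: smooth_gen_alg; apply: gen_alg_sum => i; exact: gen_base.
Qed.

Lemma derive_coord m (x : 'M[R]_(m, d)) i l j k :
  'D_(delta_mx j k) (fun y : 'M[R]_(m, d) => y i l : R) x =
  (delta_mx j k : 'M[R]_(m, d)) i l.
Proof.
rewrite deriveE; last exact: differentiable_coord.
have @g : {linear 'M[R]_(m, d) -> R}.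
  by exists (fun N : 'M[R]_(_, _) => N i l); do 2![eexists]; do ?[constructor];
     rewrite ?mxE// => ? *; rewrite ?mxE//; move=> ?; rewrite !mxE.
by rewrite (_ : (fun _ => _) = g) // diff_lin//; exact: coord_continuous.
Qed.

Lemma smooth_coord m i l : smooth_poly_growth (fun x : 'M[R]_(m, d) => x i l : R).
Proof.
pose B f := f = (fun x : 'M[R]_(m, d) => x i l : R).
apply: (@gen_alg_smooth _ B); last exact: gen_base.
  move=> f ->; split; last exact: poly_growth_coord.
  by move=> x; exact: differentiable_coord.
move=> f j k ->.
rewrite (_ : 'D__ _ = fun=> (delta_mx j k : 'M[R]_(m, d)) i l); first exact: gen_cst.
by apply/funext => x; exact: derive_coord.
Qed.

Lemma smooth_mulmx m n (P : 'M[R]_(n, m)) (f : 'M[R]_(n, d) -> R) :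
  smooth_poly_growth f -> smooth_poly_growth (fun x => f (P *m x)).
Proof.
move=> sf.
pose B (g : 'M[R]_(m, d) -> R) :=
  exists2 f0 : 'M[R]_(n, d) -> R, smooth_poly_growth f0 & g = fun x => f0 (P *m x).
apply: (@gen_alg_smooth _ B); last by apply: gen_base; exists f.
  move=> _ [g sg ->]; split; last exact: poly_growth_mulmx (sg [::]).2.
  move=> x; apply: differentiable_comp; first exact: differentiable_mulmx.
  exact: smooth_differentiable.
move=> _ i l [g sg ->].
rewrite (_ : 'D__ _ = fun x => \sum_j P j i * 'D_(delta_mx j l) g (P *m x)).
  apply: gen_alg_sum => j; apply: gen_mul; first exact: gen_cst.
  by apply: gen_base; exists ('D_(delta_mx j l) g) => //; exact: smooth_derive.
by apply/funext => x; rewrite derive_mulmx//; exact: smooth_differentiable.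
Qed.

End smooth_calculus.

Section logistic.
Context (R : realType).

Definition logistic (u : R) : R := (1 + expR (- u))^-1.

Lemma logistic_den_gt0 (u : R) : 0 < 1 + expR (- u).
Proof. by rewrite addr_gt0// expR_gt0. Qed.

Lemma logistic_ge0 u : 0 <= logistic u.
Proof. by rewrite invr_ge0 ltW// logistic_den_gt0. Qed.

Lemma logistic_le1 u : logistic u <= 1.
Proof. by rewrite invf_le1 ?logistic_den_gt0// lerDl expR_ge0. Qed.

Lemma is_derive_logistic (u : R) :
  is_derive u 1 logistic (logistic u * (1 - logistic u)).
Proof.
pose h (v : R) := 1 + expR (- v).
have dh : is_derive u 1 h (- expR (- u)).
  have e := @is_derive1_comp _ expR -%R u _ _ (is_derive_expR (- u)) (is_deriveNid u 1).
  have := is_deriveD (is_derive_cst (1 : R) u 1) e.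
  by rewrite add0r mulrN1.
have n0 : h u != 0 by rewrite gt_eqF// logistic_den_gt0.
have dl : derivable h u 1 by case: dh.
have -> : logistic u * (1 - logistic u) = 'D_1 (fun v => (h v)^-1) u.
  rewrite (@deriveV _ _ h u 1 n0 dl) derive_val /logistic -/(h u) /GRing.scale /=.
  have -> : expR (- u) = h u - 1 by rewrite /h addrC addKr.
  by field.
exact: (derivableP (@derivableV _ _ h u 1 n0 dl)).
Qed.

(** The logistic function generates an algebra stable under differentiation,
    since its derivative is logistic * (1 - logistic): this makes it a convenient
    bounded member of the class, where bump functions would need iterated
    derivatives of exp (- 1 / x). *)
Lemma smooth_logistic d m (a b : R) (i : 'I_m) (l : 'I_d) :
  smooth_poly_growth (fun x : 'M[R]_(m, d) => logistic (a * x i l + b)).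
Proof.
pose f (x : 'M[R]_(m, d)) := logistic (a * x i l + b).
pose g (u : R) := logistic (a * u + b).
have gE (u : R) : is_derive u 1 g (a * (g u * (1 - g u))).
  have h : is_derive u 1 (fun v => a * v + b) a.
    have e := is_deriveD (is_deriveZ a (is_derive_id u 1)) (is_derive_cst b u 1).
    by move: e; rewrite addr0 /GRing.scale /= mulr1.
  have := @is_derive1_comp _ logistic (fun v => a * v + b) u _ _
    (is_derive_logistic (a * u + b)) h.
  by rewrite mulrC.
have dg (u : R) : differentiable g u by apply/derivable1_diffP; case: (gE u).
have dc (x : 'M[R]_(m, d)) : differentiable (fun x : 'M[R]_(m, d) => x i l : R) x.
  exact: differentiable_coord.
have df x : differentiable f x.
  exact: (differentiable_comp (dc x) (dg (x i l))).
pose B h := h = f.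
apply: (@gen_alg_smooth _ _ _ B); last exact: gen_base.
  move=> h ->; split => //.
  exists 1, 0%N => x; rewrite expr0 mulr1 ger0_norm ?logistic_le1//.
  exact: logistic_ge0.
move=> h j k ->.
rewrite (_ : 'D__ _ = fun x =>
    a * (f x * (1 + -1 * f x)) * 'D_(delta_mx j k) (fun y : 'M[R]_(m, d) => y i l : R) x).
  apply: gen_mul.
    apply: gen_mul; first exact: gen_cst.
    apply: gen_mul; first exact: gen_base.
    apply: gen_add; first exact: gen_cst.
    by apply: gen_mul; [exact: gen_cst|exact: gen_base].
  rewrite (_ : 'D__ _ = fun=> (delta_mx j k : 'M[R]_(m, d)) i l); first exact: gen_cst.
  by apply/funext => x; exact: derive_coord.
apply/funext => x; rewrite deriveE// (diff_comp (dc x) (dg (x i l))) /=.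
rewrite deriveE// diff1E//.
have -> : derive1 g (x i l) = a * (f x * (1 - f x)).
  by rewrite derive1E; have := gE (x i l) => ?; rewrite derive_val.
by rewrite /GRing.scale /= mulrC mulN1r.
Qed.

End logistic.

(** * The algebra of cylindrical functions *)

Section grids.
Context (R : realType) (d : nat).
Local Notation time := (unit_interval R).
Local Notation tval t := (set_val t : R).

Definition is_grid k (T : 'I_k.+1 -> time) : Prop :=
  [/\ forall i, 0 < tval (T i),
      forall i j : 'I_k.+1, (i < j)%N -> tval (T i) < tval (T j) &
      tval (T ord_max) = 1].

Definition sample m (T : 'I_m -> time) (g : Omega R d) : 'M[R]_(m, d) :=
  \matrix_(i, l) path_at g (T i) ord0 l.

Lemma time_bounds (t : time) : 0 <= tval t <= 1.
Proof. by have := set_mem (valP t); rewrite /= in_itv. Qed.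

Lemma time_inj (s t : time) : tval s = tval t -> s = t.
Proof. by move=> st; exact: val_inj. Qed.

Definition to_time (x : R) : time :=
  if pselect (x \in (`[0, 1]%classic : set R)) is left h
  then exist _ x h else time0 R.

Lemma to_timeK (x : R) : 0 <= x <= 1 -> tval (to_time x) = x.
Proof.
move=> x01; rewrite /to_time; case: pselect => //.
by rewrite inE /= in_itv.
Qed.

Lemma path_at0 (g : Omega R d) (t : time) : tval t = 0 -> path_at g t = 0.
Proof.
move=> t0; have -> : t = time0 R by exact: time_inj.
by case: g => x gx; exact: (set_mem gx).
Qed.

(** The representations of cylindrical functions end at time 1, which is
    therefore added to the given times. *)
Lemma exists_grid (L : seq R) : (forall x, x \in L -> 0 < x <= 1) ->
  exists k (T : 'I_k.+1 -> time), is_grid T /\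
    forall x, x \in L -> exists j, tval (T j) = x.
Proof.
move=> L01; pose S := sort <=%R (undup (1 :: L)).
have memS x : (x \in S) = (x \in 1 :: L) by rewrite mem_sort mem_undup.
have S01 x : x \in S -> 0 < x <= 1.
  by rewrite memS inE => /orP[/eqP->|/L01//]; rewrite ltr01 lexx.
have sS : sorted <%R S by rewrite sort_lt_sorted undup_uniq.
have S1 : 1 \in S by rewrite memS mem_head.
have [k kS] : exists k, size S = k.+1.
  by exists (size S).-1; rewrite prednK//; case: (S) S1.
pose T (i : 'I_k.+1) := to_time S`_i.
have TE i : tval (T i) = S`_i.
  rewrite to_timeK//; have /S01/andP[/ltW-> ->]// : S`_i \in S.
  by rewrite mem_nth// kS.
have TS x : x \in S -> exists j, tval (T j) = x.
  move=> xS; have xk : (index x S < k.+1)%N by rewrite -kS index_mem.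
  by exists (Ordinal xk); rewrite TE /= nth_index.
have Tlt (i j : 'I_k.+1) : (i < j)%N -> tval (T i) < tval (T j).
  by move=> ij; rewrite !TE lt_sorted_ltn_nth ?inE ?kS.
exists k, T; split; last by move=> x xL; apply: TS; rewrite memS inE xL orbT.
split=> //.
  by move=> i; rewrite TE; have /S01/andP[] : S`_i \in S by rewrite mem_nth// kS.
have [j j1] := TS _ S1; apply/eqP; rewrite eq_le; apply/andP; split.
  by case/andP: (time_bounds (T ord_max)).
rewrite -[leLHS]j1; have := leq_ord j; rewrite leq_eqVlt => /orP[/eqP jk|jk].
  by have -> : j = ord_max by exact: val_inj.
exact/ltW/Tlt.
Qed.

Lemma cylZ_sample k (T : 'I_k.+1 -> time) f : is_grid T ->
  smooth_poly_growth f -> cylZ (fun g : Omega R d => f (sample T g)).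
Proof. by move=> [T0 Tlt T1] sf; exists (CylRep T0 Tlt T1 sf). Qed.

(** Selecting rows is multiplication by a 0-1 matrix; a time 0 gives a zero row
    because paths start at 0. *)
Lemma regrid m k (t : 'I_m -> time) (T : 'I_k.+1 -> time)
    (f : 'M[R]_(m, d) -> R) :
  is_grid T -> smooth_poly_growth f ->
  (forall i, tval (t i) = 0 \/ exists j, tval (T j) = tval (t i)) ->
  exists2 f' : 'M[R]_(k.+1, d) -> R, smooth_poly_growth f' &
    forall g : Omega R d, f (sample t g) = f' (sample T g).
Proof.
move=> [T0 Tlt T1] sf tT; pose P := \matrix_(i < m, j < k.+1)
  ((tval (T j) == tval (t i))%:R : R).
exists (fun x => f (P *m x)); first exact: smooth_mulmx.
move=> g; congr f; apply/matrixP => i l; rewrite !mxE.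
case: (tT i) => [ti0|[j tj]].
  rewrite path_at0// mxE big1// => j _; rewrite !mxE ti0.
  by rewrite gt_eqF ?T0// mul0r.
rewrite (bigD1 j)//= !mxE tj eqxx mul1r big1 ?addr0.
  by rewrite (time_inj tj).
move=> j' j'j; rewrite !mxE; case: eqP => [e|]; last by rewrite mul0r.
exfalso; move: j'j; rewrite -val_eqE/=; case: ltngtP => // /Tlt.
  by rewrite e tj ltxx.
by rewrite e tj ltxx.
Qed.

Lemma cylZ_times m (t : 'I_m -> time) (f : 'M[R]_(m, d) -> R) :
  smooth_poly_growth f -> cylZ (fun g : Omega R d => f (sample t g)).
Proof.
move=> sf; have [|k [T [gT TL]]] :=
  @exists_grid [seq x <- [seq tval (t i) | i <- enum 'I_m] | 0 < x].
  move=> x; rewrite mem_filter => /andP[-> /mapP[i _ ->]].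
  by case/andP: (time_bounds (t i)).
have [|f' sf' ff'] := regrid gT sf (t := t); last first.
  by under eq_fun do rewrite ff'; exact: cylZ_sample.
move=> i; have /andP[] := time_bounds (t i).
rewrite le_eqVlt => /orP[/eqP|ti0 _]; first by left.
right; apply: TL; rewrite mem_filter ti0/=; apply/mapP.
by exists i => //; rewrite mem_enum.
Qed.

(** Sums, products and derivatives of cylindrical functions are formed on a
    common grid; the additional time s serves to write the evaluation at s, and
    the derivative in the direction min(., s), on the same grid. *)
Lemma cylZ_common_grid (F G : Omega R d -> R) (s : R) :
  cylZ F -> cylZ G -> 0 < s <= 1 ->
  exists k (T : 'I_k.+1 -> time) (f h : 'M[R]_(k.+1, d) -> R) (q : 'I_k.+1),
    [/\ is_grid T, smooth_poly_growth f, smooth_poly_growth h, tval (T q) = s &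
        F = (fun g => f (sample T g)) /\ G = (fun g => h (sample T g))].
Proof.
move=> [c _ <-] [e _ <-] s01.
have pos (c0 : cyl_rep R d) i : 0 < tval (cyl_times c0 i) <= 1.
  by rewrite cyl_times_gt0; case/andP: (time_bounds (cyl_times c0 i)).
pose L (c0 : cyl_rep R d) :=
  [seq tval (cyl_times c0 i) | i <- enum (ordinal (cyl_size c0).+1)].
have L01 (c0 : cyl_rep R d) x : x \in L c0 -> 0 < x <= 1 by move=> /mapP[i _ ->].
have [|k [T [gT TL]]] := @exists_grid (s :: L c ++ L e).
  move=> x; rewrite inE mem_cat => /orP[/eqP->//|/orP[/L01//|/L01//]].
have [q qs] := TL s (mem_head _ _).
have LP (c0 : cyl_rep R d) i : tval (cyl_times c0 i) \in L c0.
  by apply/mapP; exists i => //; rewrite mem_enum.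
have [|f sf cf] := regrid (t := cyl_times c) gT (cyl_base_smooth c).
  by move=> i; right; apply: TL; rewrite inE mem_cat LP orbT.
have [|h sh eh] := regrid (t := cyl_times e) gT (cyl_base_smooth e).
  by move=> i; right; apply: TL; rewrite inE mem_cat LP !orbT.
by exists k, T, f, h, q; split=> //; split; apply/funext => g; rewrite -?cf -?eh.
Qed.

Let s1 : 0 < (1 : R) <= 1. Proof. by rewrite ltr01 lexx. Qed.

Lemma cylZ_cst (a : R) : cylZ (fun _ : Omega R d => a).
Proof.
exact: (@cylZ_times 0 (fun=> time0 R) (fun=> a) (@smooth_cst _ _ _ a)).
Qed.

Lemma cylZ_coord (t : time) (l : 'I_d) :
  cylZ (fun g : Omega R d => path_at g t ord0 l).
Proof.
have := @cylZ_times 1 (fun=> t) _ (@smooth_coord R d 1 ord0 l).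
by under eq_fun do rewrite mxE.
Qed.

Lemma cylZ_logistic (t : time) (l : 'I_d) (a b : R) :
  cylZ (fun g : Omega R d => logistic (a * path_at g t ord0 l + b)).
Proof.
have := @cylZ_times 1 (fun=> t) _ (@smooth_logistic R d 1 a b ord0 l).
by under eq_fun do rewrite mxE.
Qed.

Lemma cylZM (F G : Omega R d -> R) : cylZ F -> cylZ G ->
  cylZ (fun g => F g * G g).
Proof.
move=> ZF ZG; have [k [T [f [h [q [gT sf sh _ [-> ->]]]]]]] :=
  cylZ_common_grid ZF ZG s1.
by have := cylZ_sample gT (smoothM sf sh).
Qed.

Lemma cylZD (F G : Omega R d -> R) : cylZ F -> cylZ G ->
  cylZ (fun g => F g + G g).
Proof.
move=> ZF ZG; have [k [T [f [h [q [gT sf sh _ [-> ->]]]]]]] :=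
  cylZ_common_grid ZF ZG s1.
have sfh : smooth_poly_growth (fun x => f x + h x).
  by apply: smooth_gen_alg; apply: gen_add; exact: gen_base.
by have := cylZ_sample gT sfh.
Qed.

Lemma cylZB (F G : Omega R d -> R) : cylZ F -> cylZ G -> cylZ (F \- G).
Proof.
move=> ZF ZG; have := cylZD ZF (cylZM (cylZ_cst (-1)) ZG).
by under eq_fun do rewrite mulN1r.
Qed.

Lemma grad_sample k (T : 'I_k.+1 -> time) f (g : Omega R d) (s : R) l :
  is_grid T -> smooth_poly_growth f -> 0 <= s ->
  grad (fun g => f (sample T g)) g s ord0 l =
  \sum_i Num.min (tval (T i)) s * 'D_(delta_mx i l) f (sample T g).
Proof.
move=> [T0 Tlt T1] sf s0.
by rewrite (gradE (CylRep T0 Tlt T1 sf) g s0) mxE.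
Qed.

(** The evaluation at time s of the l-th coordinate of the gradient is the
    derivative in the direction of the reproducing element min(., s) e_l. *)
Definition dirD (F : Omega R d -> R) (s : R) (l : 'I_d) (g : Omega R d) : R :=
  grad F g s ord0 l.

Lemma cylZ_dirD F s l : cylZ F -> 0 <= s -> cylZ (dirD F s l).
Proof.
move=> ZF s0; have [k [T [f [h [q [gT sf sh _ [-> _]]]]]]] :=
  cylZ_common_grid ZF ZF s1.
rewrite (_ : dirD _ _ _ = fun g => \sum_i Num.min (tval (T i)) s *
    'D_(delta_mx i l) f (sample T g)).
  have : smooth_poly_growth (fun x => \sum_i Num.min (tval (T i)) s *
      'D_(delta_mx i l) f x).
    apply: smooth_sum => i; apply: smoothM; first exact: smooth_cst.
    exact: smooth_derive.
  exact: cylZ_sample.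
by apply/funext => g; rewrite /dirD grad_sample.
Qed.

Lemma dirDB F G s l g : cylZ F -> cylZ G -> 0 <= s ->
  dirD (F \- G) s l g = dirD F s l g - dirD G s l g.
Proof.
move=> ZF ZG s0; have [k [T [f [h [q [gT sf sh _ [-> ->]]]]]]] :=
  cylZ_common_grid ZF ZG s1.
have sfh : smooth_poly_growth (fun x => f x - h x).
  under eq_fun do rewrite -mulN1r.
  apply: smooth_gen_alg; apply: gen_add; first exact: gen_base.
  by apply: gen_mul; [exact: gen_cst|exact: gen_base].
rewrite /dirD (grad_sample g l gT sfh s0) !grad_sample// -sumrB.
apply: eq_bigr => i _; rewrite -mulrBr; congr *%R.
by apply: deriveB; apply: diff_derivable; exact: smooth_differentiable.
Qed.

Lemma dirDM F G s l g : cylZ F -> cylZ G -> 0 <= s ->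
  dirD (fun g => F g * G g) s l g = F g * dirD G s l g + G g * dirD F s l g.
Proof.
move=> ZF ZG s0; have [k [T [f [h [q [gT sf sh _ [-> ->]]]]]]] :=
  cylZ_common_grid ZF ZG s1.
have sfh := smoothM sf sh.
rewrite /dirD (grad_sample g l gT sfh s0) !grad_sample// !mulr_sumr -big_split/=.
apply: eq_bigr => i _; rewrite !(mulrCA _ (Num.min _ _)) -mulrDr; congr *%R.
by apply: deriveM; apply: diff_derivable; exact: smooth_differentiable.
Qed.

End grids.

(** * Densities and null functions *)

Section density_integral.
Context dd (T : measurableType dd) (R : realType).
Variables (m n : {measure set T -> \bar R}) (w : T -> R).
Hypothesis mw : measurable_fun setT w.
Hypothesis w0 : forall x, 0 <= w x.
Hypothesis nE : forall A, measurable A -> n A = (\int[m]_(x in A) (w x)%:E)%E.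
Local Open Scope ereal_scope.

Let mEw : measurable_fun setT (EFin \o w).
Proof. exact/measurable_EFinP. Qed.

(* For simple functions both sides are finite sums over the fibres. *)
Let density_nnsfun (h : {nnsfun T >-> R}) :
  \int[n]_x (h x)%:E = \int[m]_x ((h x)%:E * (w x)%:E).
Proof.
have indich r : measurable_fun setT (fun x => (r * \1_(h @^-1` [set r]) x)%:E).
  by apply/measurable_EFinP; exact: measurable_funM.
transitivity (\int[n]_x (\sum_(y \in range h) (y * \1_(h @^-1` [set y]) x)%:E)).
  by apply: eq_integral => t tE; rewrite /= fimfunE -fsumEFin.
transitivity (\int[m]_x (\sum_(y \in range h)
    ((y * \1_(h @^-1` [set y]) x)%:E * (w x)%:E))); last first.
  apply: eq_integral => x _; rewrite -ge0_mule_fsuml.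
    by rewrite fsumEFin // -(fimfunE _ x).
  by move=> y; exact: nnfun_muleindic_ge0.
rewrite ge0_integral_fsum//; last by move=> y x _; exact: nnfun_muleindic_ge0.
rewrite ge0_integral_fsum//; last 2 first.
- by move=> y; exact: emeasurable_funM.
- move=> y x _; rewrite mule_ge0 ?lee_fin//.
  by have := nnfun_muleindic_ge0 h y x; rewrite lee_fin.
apply: eq_fsbigr => r rh.
under eq_integral do rewrite EFinM.
rewrite integralZl_indic_nnsfun// integral_indic// setIT.
under [RHS]eq_integral do rewrite EFinM -muleA.
rewrite ge0_integralZl//.
- congr (_ * _); under eq_integral do rewrite muleC.
  rewrite (eq_integral ((EFin \o w) \_ (h @^-1` [set r]))).
    by rewrite -integral_mkcond nE.
  by move=> x xE; rewrite epatch_indic.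
- exact/emeasurable_funM/mEw/measurable_EFinP.
- by move=> t _; rewrite mule_ge0 ?lee_fin.
- by move: rh; rewrite inE => -[t _ <-]; rewrite lee_fin.
Qed.

Lemma ge0_integral_density (f : T -> \bar R) : measurable_fun setT f ->
  (forall x, 0 <= f x) -> \int[n]_x f x = \int[m]_x (f x * (w x)%:E).
Proof.
move=> mf f0; pose h := nnsfun_approx measurableT mf.
have hf x : (EFin \o h k) x @[k --> \oo] --> f x by exact: cvg_nnsfun_approx.
have -> : \int[n]_x f x = lim (\int[n]_x (EFin \o h k) x @[k --> \oo]).
  have fE x : f x = lim ((EFin \o h k) x @[k --> \oo]) by exact/esym/cvg_lim.
  under eq_integral do rewrite fE; apply: monotone_convergence => //.
  - by move=> k; apply/measurable_EFinP.
  - by move=> k x _; rewrite lee_fin.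
  - by move=> x _ a b ab; rewrite lee_fin; exact/lefP/nd_nnsfun_approx.
have -> : \int[m]_x (f x * (w x)%:E) =
    lim (\int[m]_x ((EFin \o h k) x * (w x)%:E) @[k --> \oo]).
  have fE x : f x * (w x)%:E = lim ((EFin \o h k) x * (w x)%:E @[k --> \oo]).
    by apply/esym/cvg_lim => //; exact: cvgeZr.
  under eq_integral do rewrite fE; apply: monotone_convergence => //.
  - by move=> k; exact/emeasurable_funM/mEw/measurable_EFinP.
  - by move=> k x _; rewrite mule_ge0 ?lee_fin.
  - by move=> x _ a b ab; rewrite lee_wpmul2r ?lee_fin//; exact/lefP/nd_nnsfun_approx.
by under eq_fun do rewrite density_nnsfun.
Qed.

End density_integral.

Section density_integrable.
Context dd (T : measurableType dd) (R : realType).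
Variables (m n : {measure set T -> \bar R}) (w : T -> R).
Hypothesis mw : measurable_fun setT w.
Hypothesis w0 : forall x, 0 <= w x.
Hypothesis nE : forall A, measurable A -> n A = (\int[m]_(x in A) (w x)%:E)%E.
Local Open Scope ereal_scope.

Lemma integrable_density (f : T -> \bar R) : measurable_fun setT f ->
  n.-integrable setT f <-> m.-integrable setT (fun x => f x * (w x)%:E).
Proof.
move=> mf; have mfw : measurable_fun setT (fun x => f x * (w x)%:E).
  by apply: emeasurable_funM => //; exact/measurable_EFinP.
have E : \int[n]_x `|f x| = \int[m]_x `|f x * (w x)%:E|.
  rewrite (ge0_integral_density mw w0 nE)//; last exact: measurableT_comp.
  by apply: eq_integral => x _; rewrite abseM (gee0_abs (x := (w x)%:E))// lee_fin.
by split=> /integrableP[_ fi]; apply/integrableP; split=> //;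
  [rewrite -E|rewrite E].
Qed.

Lemma integral_density (f : T -> \bar R) : measurable_fun setT f ->
  \int[n]_x f x = \int[m]_x (f x * (w x)%:E).
Proof.
move=> mf; rewrite integralE [RHS]integralE.
rewrite !(ge0_integral_density mw w0 nE)//; last 2 first.
- exact: measurable_funeneg.
- exact: measurable_funepos.
congr (_ - _); apply: eq_integral => x _.
- by rewrite !funeposE maxe_pMl ?lee_fin// mul0e.
- by rewrite !funenegE maxe_pMl ?lee_fin// mul0e mulNe.
Qed.

End density_integrable.

Section null_on_pi_system.
Context dd (T : measurableType dd) (R : realType).
Variables (nu : {measure set T -> \bar R}) (G : set (set T)) (X : T -> R).
Hypothesis mG : measurable = <<s G>>.
Hypothesis GI : setI_closed G.
Hypothesis GT : G setT.
Local Open Scope ereal_scope.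
Hypothesis iX : nu.-integrable setT (EFin \o X).
Hypothesis X0 : forall A, G A -> \int[nu]_(x in A) (X x)%:E = 0.

Let mEX : measurable_fun setT (EFin \o X). Proof. exact: measurable_int iX. Qed.
Let mp : measurable_fun setT (EFin \o X)^\+. Proof. exact: measurable_funepos. Qed.
Let mn : measurable_fun setT (EFin \o X)^\-. Proof. exact: measurable_funeneg. Qed.
Let p0 x : 0 <= (EFin \o X)^\+ x. Proof. exact: funepos_ge0. Qed.
Let n0 x : 0 <= (EFin \o X)^\- x. Proof. exact: funeneg_ge0. Qed.

(** The positive and the negative part of X are the densities of two finite
    measures which agree on a generating pi-system. *)
Lemma integral0_pi_system_ae : ae_eq nu setT (EFin \o X) (cst 0).
Proof.
pose m1 : {measure set T -> \bar R} := mdensity nu mp p0.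
pose m2 : {measure set T -> \bar R} := mdensity nu mn n0.
have fin A : measurable A ->
    (\int[nu]_(x in A) (EFin \o X)^\+ x < +oo) /\ (\int[nu]_(x in A) (EFin \o X)^\- x < +oo).
  move=> mA; have iA : nu.-integrable A (EFin \o X) by exact: integrableS iX.
  split.
    by have /integrableP[_] := integrable_funepos mA iA;
      under eq_integral do rewrite gee0_abs//.
  by have /integrableP[_] := integrable_funeneg mA iA;
    under eq_integral do rewrite gee0_abs//.
have IE A : measurable A -> \int[nu]_(x in A) (X x)%:E = m1 A - m2 A.
  by move=> mA; rewrite integralE.
have m12 A : measurable A -> m1 A = m2 A.
  apply: (measure_unique G (fun=> setT)) => //.
  - by rewrite bigcup_const//; exists 0%N.
  - move=> B GB; have mB : measurable B by rewrite mG; exact: sub_sigma_algebra.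
    have := X0 GB; rewrite IE// => /eqP; rewrite sube_eq; last 2 first.
    + rewrite ge0_fin_numE; last exact: measure_ge0.
      exact: (fin B mB).1.
    + rewrite fin_num_adde_defl//.
      rewrite ge0_fin_numE; last exact: measure_ge0.
      exact: (fin B mB).2.
    by rewrite add0e => /eqP.
  - by move=> _; exact: (fin setT measurableT).1.
apply: integral_ae_eq => // E _ mE; rewrite IE// m12// integral0 subee//.
by rewrite ge0_fin_numE; [exact: (fin E mE).2|exact: measure_ge0].
Qed.

End null_on_pi_system.

(** * Measurability in the entries of a matrix *)

Section matrix_measurable.
Context (R : realType) (m n : nat).
Local Notation M := 'M[R]_(m, n).

(** The sigma-algebra generated by the entries plays the role of the Borel
    sigma-algebra of the space of matrices; product measures are determined on
    rectangles, and continuous functions turn out to be measurable. *)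
Definition entry_events : set (set M) :=
  [set A | exists i, exists j, exists2 B : set R,
     measurable B & A = [set x : M | B (x i j)]].

Definition mxT := g_sigma_algebraType entry_events.
HB.instance Definition _ := Measurable.on mxT.

Lemma measurable_entry i j : measurable_fun setT (fun x : mxT => x i j).
Proof.
move=> _ B mB; rewrite setTI; apply: sub_sigma_algebra.
by exists i, j, B.
Qed.

Lemma measurable_mxT dd (T : measurableType dd) (V : T -> mxT) :
  (forall i j, measurable_fun setT (fun t => V t i j)) -> measurable_fun setT V.
Proof.
move=> mV; apply: (@measurability _ _ T mxT setT V entry_events) => //.
move=> _ [_ [i [j [B mB ->]]] <-].
exact: (mV i j measurableT B mB).
Qed.

Lemma measurable_rectangle (B : 'I_m -> 'I_n -> set R) :
  (forall i j, measurable (B i j)) ->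
  measurable [set x : mxT | forall i j, B i j (x i j)].
Proof.
move=> mB.
have -> : [set x : mxT | forall i j, B i j (x i j)] =
    \bigcap_(i in [set: 'I_m]) \bigcap_(j in [set: 'I_n]) [set x : mxT | B i j (x i j)].
  apply/seteqP; split=> x /= Bx; first by move=> i _ j _; exact: Bx.
  by move=> i j; exact: Bx i I j I.
apply: fin_bigcap_measurable; first exact: finite_finset.
move=> i _; apply: fin_bigcap_measurable; first exact: finite_finset.
move=> j _; rewrite -[X in measurable X]setTI.
exact: (@measurable_entry i j).
Qed.

Definition rectangles : set (set mxT) :=
  [set A | exists2 B : 'I_m -> 'I_n -> set R, (forall i j, measurable (B i j)) &
     A = [set x : mxT | forall i j, B i j (x i j)]].

Lemma rectanglesT : rectangles setT.
Proof. by exists (fun _ _ => setT) => //; apply/seteqP; split. Qed.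

Lemma rectanglesI : setI_closed rectangles.
Proof.
move=> _ _ [B mB ->] [C mC ->]; exists (fun i j => B i j `&` C i j).
  by move=> i j; exact: measurableI.
apply/seteqP; split=> [x [Bx Cx] i j|x BC]; first by split; [exact: Bx|exact: Cx].
by split=> i j; have [] := BC i j.
Qed.

Lemma rectangles_generate : measurable = <<s rectangles>>.
Proof.
apply/seteqP; split.
- apply: smallest_sub; first exact: smallest_sigma_algebra.
  move=> _ [i [j [B mB ->]]]; apply: sub_sigma_algebra.
  exists (fun a b => if (a == i) && (b == j) then B else setT).
    by move=> a b; case: ifP.
  apply/seteqP; split=> x /=; last by move=> /(_ i j); rewrite !eqxx.
  by move=> Bx a b; case: ifP => // /andP[/eqP-> /eqP->].
- apply: smallest_sub; first exact: sigma_algebra_measurable.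
  by move=> _ [B mB ->]; exact: measurable_rectangle.
Qed.

Let disc (k : nat) (z : 'M[int]_(m, n)) : M :=
  \matrix_(i, j) ((z i j)%:~R / k.+1%:R).
Let disc_index (k : nat) (x : M) : 'M[int]_(m, n) :=
  \matrix_(i, j) Num.floor (x i j * k.+1%:R).

Let disc_dist k x : `|x - disc k (disc_index k x)| <= k.+1%:R^-1.
Proof.
rewrite [leLHS]/Num.norm /= mx_normrE; apply/bigmax_leP; split=> // -[i j] _ /=.
rewrite !mxE; set u := x i j.
have k0 : 0 < k.+1%:R :> R by rewrite ltr0n.
have /andP[f1 f2] := floor_itv (u * k.+1%:R).
rewrite -[X in `|X - _|](mulfK (lt0r_neq0 k0) u) -mulrBl normrM.
have k1 : 0 <= k.+1%:R^-1 :> R by rewrite invr_ge0.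
rewrite [X in _ * X]ger0_norm// ler_piMl// ger0_norm ?subr_ge0//.
by move: f2; rewrite intrD; lra.
Qed.

(** A continuous function is the limit of its values at the points of finer
    and finer lattices, and countably many cells cover the space. *)
Lemma continuous_measurable_mx (f : M -> R) :
  continuous f -> measurable_fun setT (f : mxT -> R).
Proof.
move=> cf; pose h k (x : mxT) := f (disc k (disc_index k x)).
apply: (@measurable_fun_cvg _ _ _ _ h).
- move=> k _ B mB; rewrite setTI.
  have -> : h k @^-1` B = \bigcup_(z in [set: 'M[int]_(m, n)])
      ([set x : mxT | forall i j, [set u | Num.floor (u * k.+1%:R) = z i j] (x i j)]
        `&` [set x : mxT | B (f (disc k z))]).
    apply/seteqP; split=> x /=.
      by move=> Bx; exists (disc_index k x) => //; split=> // i j; rewrite /= mxE.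
    move=> [z _ [xz]]; rewrite /= /h; suff -> : disc_index k x = z by [].
    by apply/matrixP => i j; rewrite mxE xz.
  apply: (countable_bigcupT_measurable (countableP [set: 'M[int]_(m, n)])).
  move=> z; apply: measurableI; last first.
    have [Bz|Bz] := pselect (B (f (disc k z))).
      by rewrite (_ : [set _ | _] = setT)//; apply/seteqP; split.
    by rewrite (_ : [set _ | _] = set0)//; apply/seteqP; split.
  apply: (@measurable_rectangle
    (fun i j => [set u : R | Num.floor (u * k.+1%:R) = z i j])) => i j.
  have -> : [set u : R | Num.floor (u * k.+1%:R) = z i j] =
      `[(z i j)%:~R / k.+1%:R, (z i j + 1)%:~R / k.+1%:R[%classic.
    have k0 : 0 < k.+1%:R :> R by rewrite ltr0n.
    apply/seteqP; split=> u /=; rewrite in_itv/= ler_pdivrMr// ltr_pdivlMr//.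
      by move=> <-; exact: floor_itv.
    by move=> uz; exact: floor_def.
  exact: measurable_itv.
- move=> x _; apply: continuous_cvg; first exact: cf.
  apply/cvgrPdist_le => e e0; near=> k.
  apply: (le_trans (disc_dist k x)); apply: ltW.
  near: k; exact: (near_infty_natSinv_lt (PosNum e0)).
Unshelve. all: by end_near. Qed.

End matrix_measurable.

(** * Integration by parts for a centred Gaussian variable *)

Section gaussian_ibp.
Context (R : realType).
Local Notation mu := (@lebesgue_measure R).

(** By dominated convergence the integral is the limit of those over [-n, n],
    which the fundamental theorem of calculus evaluates to g n - g (- n). *)
Lemma integral_derivative_eq0 (g g' : R -> R) :
  (forall x : R, is_derive x 1 g (g' x)) -> continuous g' ->
  mu.-integrable setT (EFin \o g') ->
  g n%:R @[n --> \oo] --> 0 -> g (- n%:R) @[n --> \oo] --> 0 ->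
  (\int[mu]_x (g' x)%:E = 0)%E.
Proof.
move=> dg cg' ig gy gNy.
pose D (n : nat) : set R := `[- n%:R, n%:R]%classic.
pose f_ n : R -> \bar R := (EFin \o g') \_ (D n).
have mg' : measurable_fun setT (EFin \o g') by exact: measurable_int ig.
have mf n : measurable_fun setT (f_ n).
  have mD : measurable (D n) by exact: measurable_itv.
  apply/(@measurable_restrictT _ _ _ _ _ (EFin \o g') mD).
  exact: (measurable_funS measurableT (@subsetT _ _)).
have [] := @dominated_convergence _ _ _ mu setT measurableT f_ (EFin \o g')
    (fun x => `|(g' x)%:E|)%E mf mg'.
- apply: aeW => x _; apply: cvg_near_cst.
  near=> n; rewrite /f_ patchE mem_set// /D /= in_itv/= -ler_norml.
  by near: n; exact: nbhs_infty_ger.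
- exact: integrable_abse ig.
- apply: aeW => x n _; rewrite /f_ patchE; case: ifP => // _.
  by rewrite abse0 abse_ge0.
move=> _ _; set I := (X in _ --> X) => cI.
suff c0 : [sequence (\int[mu]_x f_ n x)%E]_n @ \oo --> 0%E.
  by apply/esym; apply: cvg_unique cI.
have fE : \forall n \near \oo, (g n%:R - g (- n%:R))%:E = [sequence (\int[mu]_x f_ n x)%E]_n n.
  near=> n; rewrite /= /f_ -integral_mkcond EFinB.
  have n0 : 0 < n%:R :> R by rewrite ltr0n; near: n; exact: nbhs_infty_gt.
  rewrite /D (@continuous_FTC2 _ g' g)//.
  - by rewrite gtrN.
  - exact: continuous_subspaceT.
  - have cg x : {for x, continuous g}.
      apply: differentiable_continuous; apply/derivable1_diffP.
      by case: (dg x).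
    split.
    + by move=> x _; case: (dg x).
    + exact/cvg_at_right_filter/cg.
    + exact/cvg_at_left_filter/cg.
  - by move=> x _; rewrite derive1E; have := dg x => ?; rewrite derive_val.
have : (g n%:R - g (- n%:R))%:E @[n --> \oo] --> 0%:E.
  apply: cvg_EFin; first by near=> n.
  by rewrite -[X in _ --> X]subr0; exact: cvgB.
by apply: cvg_trans; apply: near_eq_cvg.
Unshelve. all: by end_near. Qed.

Variable sigma : R.
Hypothesis sigma0 : 0 < sigma.
Let s0 : sigma != 0. Proof. by rewrite gt_eqF. Qed.
Local Notation p := (normal_pdf 0 sigma).

Lemma is_derive_normal_pdf (x : R) : is_derive x 1 p (- (x / sigma ^+ 2 * p x)).
Proof.
pose q (x : R) := - (x - 0) ^+ 2 / (sigma ^+ 2 *+ 2).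
have dq : is_derive x 1 q (- (x / sigma ^+ 2)).
  rewrite (_ : q = fun x => (- (sigma ^+ 2 *+ 2)^-1) *: (x * x)); last first.
    by apply/funext => y; rewrite /q subr0 /GRing.scale/= mulNr mulrC mulNr expr2.
  have e := is_deriveZ (- (sigma ^+ 2 *+ 2)^-1)
    (is_deriveM (is_derive_id x 1) (is_derive_id x 1)).
  move: e; rewrite (_ : _ *: _ = - (x / sigma ^+ 2))//.
  by rewrite /GRing.scale/= -mulr_natr; field.
have := is_deriveZ (normal_peak sigma)
  (@is_derive1_comp _ expR q x _ _ (is_derive_expR (q x)) dq).
rewrite normal_pdfE//.
rewrite (_ : _ *: _ = - (x / sigma ^+ 2 * (normal_peak sigma * normal_fun 0 sigma x)))//.
by rewrite /GRing.scale/= /normal_fun -/(q x) mulrN mulrN mulrA mulrC.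
Qed.

Lemma normal_pdf_opp (x : R) : p (- x) = p x.
Proof. by rewrite normal_pdfE// /normal_fun !subr0 sqrrN. Qed.

(** The Gaussian density beats every polynomial, as exp y >= y^k / k!. *)
Lemma poly_normal_pdf_cvg0 (g : R -> R) C N :
  (forall x, `|g x| <= C * (1 + `|x|) ^+ N * p x) ->
  g n%:R @[n --> \oo] --> 0 /\ g (- n%:R) @[n --> \oo] --> 0.
Proof.
move=> gp.
pose c := (sigma ^+ 2 *+ 2)^-1.
have c0 : 0 < c by rewrite invr_gt0 pmulrn_lgt0// exprn_gt0.
(* From exp (c n^2) >= (c n^2)^(N+1) / (N+1)! and (1 + n)^N <= (2 n)^N. *)
pose K := `|C| * 2 ^+ N * normal_peak sigma * (N.+1`!%:R / c ^+ N.+1).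
have pn (n : nat) : (0 < n)%N ->
    C * (1 + n%:R) ^+ N * p n%:R <= K * n%:R^-1.
  move=> n0; have n1 : 1 <= n%:R :> R by rewrite ler1n.
  have np : 0 < n%:R :> R by rewrite ltr0n.
  have fp : 0 < N.+1`!%:R :> R by rewrite ltr0n fact_gt0.
  have e1 : (c * n%:R ^+ 2) ^+ N.+1 / N.+1`!%:R <= expR (c * n%:R ^+ 2).
    have := @expR_ge1Dxn _ (c * n%:R ^+ 2) N.
    by move=> /(_ _)/(le_trans _); apply; rewrite ?lerDr// mulr_ge0 ?sqr_ge0// ltW.
  have q0 : 0 < (c * n%:R ^+ 2) ^+ N.+1 / N.+1`!%:R.
    by rewrite divr_gt0// exprn_gt0// mulr_gt0// exprn_gt0.
  have e2 : p n%:R <= normal_peak sigma * ((c * n%:R ^+ 2) ^+ N.+1 / N.+1`!%:R)^-1.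
    rewrite normal_pdfE// ler_wpM2l ?normal_peak_ge0// /normal_fun subr0.
    rewrite mulNr expRN mulrC -/c ler_pV2 ?inE ?unitfE ?gt_eqF ?expR_gt0//.
  have e3 : C * (1 + n%:R) ^+ N <= `|C| * (2 * n%:R) ^+ N.
    apply: (@le_trans _ _ (`|C| * (1 + n%:R) ^+ N)).
      by rewrite ler_wpM2r ?exprn_ge0 ?addr_ge0// ler_norm.
    rewrite ler_wpM2l// lerXn2r ?nnegrE ?addr_ge0 ?mulr_ge0//; lra.
  apply: (@le_trans _ _ (`|C| * (2 * n%:R) ^+ N *
      (normal_peak sigma * ((c * n%:R ^+ 2) ^+ N.+1 / N.+1`!%:R)^-1))).
    apply: (@le_trans _ _ (`|C| * (2 * n%:R) ^+ N * p n%:R)).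
      by rewrite ler_wpM2r// normal_pdf_ge0.
    by rewrite ler_wpM2l// mulr_ge0// exprn_ge0// mulr_ge0.
  have -> : `|C| * (2 * n%:R) ^+ N *
      (normal_peak sigma * ((c * n%:R ^+ 2) ^+ N.+1 / N.+1`!%:R)^-1) =
      K * (n%:R ^+ N / n%:R ^+ (2 * N.+1)).
    have cN : c ^+ N.+1 != 0 by rewrite gt_eqF// exprn_gt0.
    have nN : n%:R ^+ N.+1 != 0 :> R by rewrite gt_eqF// exprn_gt0.
    have fN : N.+1`!%:R != 0 :> R by rewrite gt_eqF.
    rewrite /K !exprMn mul2n -addnn exprD; move: cN nN fN.
    move: (c ^+ N.+1) (n%:R ^+ N.+1) (N.+1`!%:R) (n%:R ^+ N) (2 ^+ N) `|C|.
    move: (normal_peak sigma) => a1 a2 a3 a4 a5 a6 a7 a20 a30 a40. field.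
    by rewrite a20 a30 a40.
  have K0 : 0 <= K.
    rewrite /K; apply: mulr_ge0; last by rewrite divr_ge0// exprn_ge0// ltW.
    by rewrite mulr_ge0 ?normal_peak_ge0// mulr_ge0// exprn_ge0.
  rewrite ler_wpM2l//.
  rewrite ler_pdivrMr ?exprn_gt0// mulrC ler_pdivlMr// -exprSr ler_weXn2l//.
  by rewrite leq_pmull.
have K0 : K * n%:R^-1 @[n --> \oo] --> 0.
  rewrite -[X in _ --> X](mulr0 K); apply: cvgMr.
  by rewrite -(cvg_shiftS (fun n => n%:R^-1 : R)); exact: cvg_harmonic.
split.
- apply/norm_cvg0P; apply: squeeze_cvgr K0; last exact: cvg_cst.
  near=> n; rewrite normr_ge0/=.
  apply: (le_trans (gp _)); rewrite ger0_norm//; apply: pn.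
  by near: n; exact: nbhs_infty_gt.
- apply/norm_cvg0P; apply: squeeze_cvgr K0; last exact: cvg_cst.
  near=> n; rewrite normr_ge0/=.
  apply: (le_trans (gp _)); rewrite normrN ger0_norm// normal_pdf_opp; apply: pn.
  by near: n; exact: nbhs_infty_gt.
Unshelve. all: by end_near. Qed.

Local Notation N := (normal_prob 0 sigma).

(** The density p satisfies p' x = - (x / sigma^2) p x, so f' x - f x * x / sigma^2
    is, up to the factor p x, the derivative of f * p, whose integral vanishes. *)
Lemma gaussian_ibp (f f' : R -> R) C k :
  (forall x : R, is_derive x 1 f (f' x)) -> continuous f' ->
  (forall x, `|f x| <= C * (1 + `|x|) ^+ k) ->
  N.-integrable setT (fun x => (f x * x)%:E) ->
  N.-integrable setT (fun x => (f' x)%:E) ->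
  (\int[N]_x (f x * x)%:E = (sigma ^+ 2)%:E * \int[N]_x (f' x)%:E)%E.
Proof.
move=> df cf' fC ifx if'.
have mp : measurable_fun setT p by exact: measurable_normal_pdf.
have p0 x : 0 <= p x by exact: normal_pdf_ge0.
have NE A : measurable A -> N A = (\int[mu]_(x in A) (p x)%:E)%E by [].
have mfx := measurable_int _ ifx.
have mf' := measurable_int _ if'.
pose T := measurableTypeR R.
rewrite (@integral_density _ T R mu N p mp p0 NE _ mfx).
rewrite (@integral_density _ T R mu N p mp p0 NE _ mf').
move/(@integrable_density _ T R mu N p mp p0 NE _ mfx) : ifx => ifx.
move/(@integrable_density _ T R mu N p mp p0 NE _ mf') : if' => if'.
pose g x := f x * p x.
pose g' x := f' x * p x - (sigma ^+ 2)^-1 * (f x * x * p x).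
have cf : continuous f.
  move=> x; apply: differentiable_continuous; apply/derivable1_diffP.
  by case: (df x).
have cp : continuous p by exact: continuous_normal_pdf.
have dg (x : R) : is_derive x 1 g (g' x).
  have := is_deriveM (df x) (is_derive_normal_pdf x).
  rewrite (_ : _ + _ = g' x)//.
  by rewrite /g' /GRing.scale/=; ring.
have cg' : continuous g'.
  move=> x; apply: cvgB; first by apply: cvgM; [exact: cf'|exact: cp].
  apply: cvgMr; apply: cvgM; last exact: cp.
  by apply: cvgM; [exact: cf|exact: cvg_id].
have ig2 := integrableZl measurableT (sigma ^+ 2)^-1 ifx.
have ig' : mu.-integrable setT (EFin \o g').
  by have := integrableB measurableT if' ig2; apply: eq_integrable => //.
have gb x : `|g x| <= C * (1 + `|x|) ^+ k * p x.
  by rewrite normrM (ger0_norm (p0 x)) ler_wpM2r.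
have [gy gNy] := poly_normal_pdf_cvg0 gb.
have := integral_derivative_eq0 dg cg' ig' gy gNy.
have -> : (\int[mu]_x (g' x)%:E = \int[mu]_x ((f' x)%:E * (p x)%:E) -
   (sigma ^+ 2)^-1%:E * \int[mu]_x ((f x * x)%:E * (p x)%:E))%E.
  rewrite -integralZl// -integralB//; apply: eq_integral => x _.
set a := (X in (X - _)%E); set b := (X in (_ - _ * X)%E).
have af : a \is a fin_num by exact: integrable_fin_num.
have bf : b \is a fin_num by exact: integrable_fin_num.
rewrite -[X in _ -> X]/(b = _ * a)%E.
rewrite -(fineK af) -(fineK bf) -EFinM -EFinB => -[] /subr0_eq ->.
by rewrite -EFinM mulrA divff ?mul1r// expf_neq0.
Qed.

End gaussian_ibp.

(** * Integration by parts on Wiener space *)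

Section line_derivative.
Context (R : realType) (m n : nat).

Lemma is_derive_line (f : 'M[R]_(m, n) -> R) (a v : 'M[R]_(m, n)) (x : R) :
  derivable f (a + x *: v) v ->
  is_derive x 1 (fun y : R => f (a + y *: v)) ('D_v f (a + x *: v)).
Proof.
move=> df.
have E : (fun h : R => h^-1 *: (((fun y => f (a + y *: v)) \o shift x) (h *: (1 : R)) -
    f (a + x *: v))) =
    (fun h => h^-1 *: ((f \o shift (a + x *: v)) (h *: v) - f (a + x *: v))).
  apply/funext => h /=; congr (_ *: (f _ - _)).
  by rewrite [h *: 1]mulr1 scalerDl addrCA.
by split; rewrite /derivable /derive E.
Qed.

End line_derivative.

Section change_of_law.
Context d1 d2 d3 (X : measurableType d1) (X' : measurableType d2)
  (Y : measurableType d3) (R : realType).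
Variables (P : {measure set X -> \bar R}) (P' : {measure set X' -> \bar R}).
Variables (U : X -> Y) (U' : X' -> Y).
Hypotheses (mU : measurable_fun setT U) (mU' : measurable_fun setT U').
Hypothesis PP' : forall A, measurable A -> P (U @^-1` A) = P' (U' @^-1` A).
Variables (h : Y -> \bar R).
Hypotheses (mh : measurable_fun setT h) (ih : P.-integrable setT (h \o U)).

Let mhU' : measurable_fun setT (h \o U'). Proof. exact: measurableT_comp. Qed.

Lemma integrable_same_law : P'.-integrable setT (h \o U').
Proof.
apply/integrableP; split=> //; have /integrableP[_] := ih; apply: le_lt_trans.
have mah : measurable_fun setT (abse \o h) by exact: measurableT_comp.
have := ge0_integral_pushforward mU P measurableT mah
  (fun y _ => abse_ge0 (h y)).
have := ge0_integral_pushforward mU' P' measurableT mah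
  (fun y _ => abse_ge0 (h y)).
rewrite !preimage_setT => <- <-.
by rewrite (@eq_measure_integral _ _ _ setT (pushforward P U))// => A mA _; exact/esym/PP'.
Qed.

Lemma integral_same_law :
  (\int[P]_x h (U x) = \int[P']_x h (U' x))%E.
Proof.
have ih1 : P.-integrable (U @^-1` setT) (h \o U) by rewrite preimage_setT.
have ih2 : P'.-integrable (U' @^-1` setT) (h \o U').
  by rewrite preimage_setT; exact: integrable_same_law.
have := integral_pushforward mU mh ih1 measurableT.
have := integral_pushforward mU' mh ih2 measurableT.
rewrite !preimage_setT => <- <-.
by rewrite (@eq_measure_integral _ _ _ setT (pushforward P' U'))// => A mA _; exact: PP'.
Qed.

End change_of_law.

Section fubini_change_of_law.
Context d1 d2 d3 (X : measurableType d1) (X' : measurableType d2)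
  (Y : measurableType d3) (R : realType).
Variables (P : probability X R) (Q : probability X' R).
Variables (U : X -> Y) (V : X * X' -> Y).
Hypotheses (mU : measurable_fun setT U) (mV : measurable_fun setT V).
Hypothesis UV : forall A, measurable A -> P (U @^-1` A) = (P \x Q)%E (V @^-1` A).

(** A proportionality of integrals which holds for the second factor of a
    product space passes by Fubini to every variable distributed like V; almost
    every section is integrable, so it suffices to know it for those. *)
Lemma integral_scale_same_law (h1 h2 : Y -> \bar R) (c : R) :
  measurable_fun setT h1 -> measurable_fun setT h2 ->
  P.-integrable setT (h1 \o U) -> P.-integrable setT (h2 \o U) ->
  (forall y, Q.-integrable setT (fun x => h1 (V (y, x))) ->
     Q.-integrable setT (fun x => h2 (V (y, x))) ->
     (\int[Q]_x h1 (V (y, x)) = c%:E * \int[Q]_x h2 (V (y, x)))%E) ->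
  (\int[P]_x h1 (U x) = c%:E * \int[P]_x h2 (U x))%E.
Proof.
move=> mh1 mh2 i1 i2 H.
have i1' := integrable_same_law mU mV UV mh1 i1.
have i2' := integrable_same_law mU mV UV mh2 i2.
rewrite (integral_same_law mU mV UV mh1 i1) (integral_same_law mU mV UV mh2 i2).
rewrite -(integral12_prod_meas1 i1') -(integral12_prod_meas1 i2').
have iF2 := integrable_fubini_F i2'.
rewrite -integralZl//; apply: ae_eq_integral => //.
- exact: measurable_fubini_F i1'.
- by apply: measurable_funeM; exact: measurable_fubini_F i2'.
have := ae_integrable1 i1'; have := ae_integrable1 i2'.
by apply: filterS2 => y /= iy2 iy1 _; exact: H.
Qed.

End fubini_change_of_law.

Section wiener_increments.
Context (R : realType) (d : nat).
Variables (nu : probability (Omega R d) R) (wiener_nu : is_wiener nu).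
Variables (k : nat) (T : 'I_k.+1 -> unit_interval R) (gridT : is_grid T).
Local Notation tval t := (set_val t : R).

Let n := k.+1.

(** The increments over a grid starting at 0 determine the values on it. *)
Definition grid0 (i : 'I_n.+1) : unit_interval R :=
  if unlift ord0 i is Some j then T j else time0 R.

Lemma grid0_lift j : grid0 (lift ord0 j) = T j.
Proof. by rewrite /grid0 liftK. Qed.

Lemma grid0_0 : grid0 ord0 = time0 R.
Proof. by rewrite /grid0 unlift_none. Qed.

Lemma grid0_lt (i j : 'I_n.+1) : (i < j)%N -> tval (grid0 i) < tval (grid0 j).
Proof.
have [T0 Tlt _] := gridT.
rewrite /grid0; case: unliftP => [i' ->|->]; case: unliftP => [j' ->|->].
- by rewrite !lift0 ltnS => /Tlt.
- by [].
- by move=> _; exact: T0.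
- by rewrite ltnn.
Qed.

Local Notation gl j := (grid0 (widen_ord (leqnSn n) j)).
Local Notation gr j := (grid0 (lift ord0 j)).

Definition grid_step (j : 'I_n) : R := tval (gr j) - tval (gl j).

Lemma grid_step_gt0 j : 0 < grid_step j.
Proof. by rewrite subr_gt0; apply: grid0_lt; rewrite lift0. Qed.

Definition increments (g : Omega R d) : mxT R n d :=
  \matrix_(j, l) (path_at g (gr j) ord0 l - path_at g (gl j) ord0 l).

Lemma sum_increments (V : zmodType) (a : 'I_n.+1 -> V) (i : 'I_n) :
  a ord0 = 0 ->
  \sum_(j < n | (j <= i)%N) (a (lift ord0 j) - a (widen_ord (leqnSn n) j)) =
  a (lift ord0 i).
Proof.
move=> a0; pose b m := a (inord m).
transitivity (\sum_(j < n | (j < i.+1)%N) (b j.+1 - b j)).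
  apply: eq_bigr => j _; congr (a _ - a _); apply: val_inj => /=.
    by rewrite inordK; [by []|have := ltn_ord j; rewrite ltnS].
  by rewrite inordK// ltnS ltnW.
rewrite -(big_ord_widen _ (fun j => b j.+1 - b j))// -(big_mkord xpredT (fun j => b j.+1 - b j)).
rewrite telescope_sumr// /b (_ : inord 0 = ord0); last first.
  by apply: val_inj; rewrite /= inordK.
rewrite a0 subr0; congr a; apply: val_inj => /=.
by rewrite inordK; [by []|have := ltn_ord i; rewrite ltnS].
Qed.

(** The values of a path on the grid are the partial sums of its increments. *)
Definition cumul : 'M[R]_(n, n) := \matrix_(i, j) ((j <= i)%N)%:R.

Lemma sample_increments g : sample T g = cumul *m increments g.
Proof.
apply/matrixP => i l; rewrite !mxE.
transitivity (\sum_(j < n | (j <= i)%N)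
   (path_at g (gr j) ord0 l - path_at g (gl j) ord0 l)); last first.
  rewrite [RHS](eq_bigr (fun j : 'I_n => if (j <= i)%N then
    path_at g (gr j) ord0 l - path_at g (gl j) ord0 l else 0)).
    by rewrite -big_mkcond.
  by move=> j _; rewrite !mxE; case: leqP; rewrite ?mul1r ?mul0r.
rewrite (@sum_increments _ (fun j => path_at g (grid0 j) ord0 l)).
  by rewrite grid0_lift.
by rewrite grid0_0 path_at0// mxE.
Qed.

Lemma sum_grid_step (i : 'I_n) : \sum_(j < n | (j <= i)%N) grid_step j = tval (T i).
Proof.
by rewrite (@sum_increments _ (fun j => tval (grid0 j))) ?grid0_lift// grid0_0.
Qed.

Lemma measurable_path_at (t : unit_interval R) (l : 'I_d) :
  measurable_fun setT (fun g : Omega R d => path_at g t ord0 l).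
Proof.
by move=> _ B mB; rewrite setTI; apply: sub_sigma_algebra; exists t, l, B.
Qed.

Lemma measurable_increments : measurable_fun setT increments.
Proof.
apply: measurable_mxT => j l.
under eq_fun do rewrite mxE.
by apply: measurable_funB; exact: measurable_path_at.
Qed.

Local Notation N j := (normal_prob 0 (Num.sqrt (grid_step j))).

Lemma increments_law (B : 'I_n -> 'I_d -> set R) :
  (forall j l, measurable (B j l)) ->
  nu [set g | forall j l, B j l (increments g j l)] =
  (\prod_(p : 'I_n * 'I_d) N p.1 (B p.1 p.2))%E.
Proof.
move=> mB; rewrite -(pair_bigA _ (fun j l => N j (B j l)))/=.
rewrite -(wiener_nu grid0_lt mB); congr (nu _).
by apply/seteqP; split=> g /= + j l => /(_ j l); rewrite !mxE.
Qed.

Section resampling.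
Variables (j0 : 'I_n) (l0 : 'I_d).

(** The replaced increment becomes an integration variable of its own. *)
Definition resample (gx : Omega R d * measurableTypeR R) : mxT R n d :=
  \matrix_(j, l) if (j == j0) && (l == l0) then gx.2 else increments gx.1 j l.

Lemma resampleE x g :
  resample (g, x) = resample (g, 0) + x *: (delta_mx j0 l0 : 'M[R]_(n, d)).
Proof.
apply/matrixP => j l; rewrite !mxE; case: ifP => _.
  by rewrite mulr1 add0r.
by rewrite mulr0 addr0.
Qed.

Lemma measurable_resample : measurable_fun setT resample.
Proof.
apply: measurable_mxT => j l; under eq_fun do rewrite mxE.
have m1 : measurable_fun setT (fun gx : Omega R d * measurableTypeR R => gx.1) :=
  @measurable_fst _ _ (Omega R d) (measurableTypeR R).
have m2 : measurable_fun setT (fun gx : Omega R d * measurableTypeR R => gx.2) :=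
  @measurable_snd _ _ (Omega R d) (measurableTypeR R).
have m3 : measurable_fun setT (fun g => increments g j l) :=
  measurableT_comp (@measurable_entry R n d j l) measurable_increments.
case: (_ && _); first exact: m2.
exact: (measurableT_comp m3 m1).
Qed.

(** On rectangles both sides are products of Gaussian probabilities by the
    definition of the Wiener measure, and rectangles form a generating
    pi-system. *)
Lemma resample_law (A : set (mxT R n d)) : measurable A ->
  nu (increments @^-1` A) = (nu \x N j0)%E (resample @^-1` A).
Proof.
move=> mA.
pose m1 : {measure set (mxT R n d) -> \bar R} :=
  measure_function_pushforward__canonical__measure_function_Measure nu measurable_increments.
pose m2 : {measure set (mxT R n d) -> \bar R} :=
  measure_function_pushforward__canonical__measure_function_Measure (nu \x N j0)%E measurable_resample.
suff : m1 A = m2 A by [].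
apply: (measure_unique (@rectangles R n d) (fun=> setT)) => //.
- exact: rectangles_generate.
- exact: rectanglesI.
- by move=> _; exact: rectanglesT.
- by rewrite bigcup_const//; exists 0%N.
- move=> _ [B mB ->]; rewrite /m1 /m2 /= /pushforward.
  pose B' (j : 'I_n) (l : 'I_d) := if (j == j0) && (l == l0) then setT else B j l.
  have mB' j l : measurable (B' j l) by rewrite /B'; case: ifP.
  have -> : resample @^-1` [set x | forall i j, B i j (x i j)] =
      [set g | forall (j : 'I_n) (l : 'I_d), B' j l (increments g j l)] `*` B j0 l0.
    apply/seteqP; split=> [[g x]/= H|[g x] /= [H Bx] j l].
      split; last by have := H j0 l0; rewrite mxE !eqxx.
      by move=> j l; have := H j l; rewrite /B' mxE; case: ifP.
    by have := H j l; rewrite /B' [resample _ _ _]mxE; case: ifP => // /andP[/eqP-> /eqP->].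
  have mS : measurable [set g | forall (j : 'I_n) (l : 'I_d), B' j l (increments g j l)].
    rewrite -[X in measurable X]setTI.
    exact: (measurable_increments measurableT (measurable_rectangle mB')).
  have mB0 : measurable (B j0 l0 : set (measurableTypeR R)) by exact: mB.
  rewrite (product_measure1E _ _ mS mB0) muleC.
  transitivity (nu [set g | forall j l, B j l (increments g j l)]); first by [].
  rewrite (increments_law mB) [X in _ = (_ * X)%E](increments_law mB').
  rewrite (bigD1 (j0, l0))//= [in RHS](bigD1 (j0, l0))//=.
  rewrite /B' !eqxx/= probability_setT mul1e; congr (_ * _)%E.
  by apply: eq_bigr => -[j l] /=; rewrite xpair_eqE => /negbTE ->.
- by move=> _; rewrite /m1 /= /pushforward preimage_setT probability_setT ltry.
Qed.

Local Open Scope ereal_scope.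

(** The increment is independent of the others, so that Fubini's theorem
    reduces the claim to one Gaussian variable. *)
Lemma increment_ibp (psi : 'M[R]_(n, d) -> R) :
  smooth_poly_growth psi ->
  nu.-integrable setT (fun g => (psi (increments g) * increments g j0 l0)%:E) ->
  nu.-integrable setT (fun g => ('D_(delta_mx j0 l0) psi (increments g))%:E) ->
  \int[nu]_g (psi (increments g) * increments g j0 l0)%:E =
  (grid_step j0)%:E * \int[nu]_g ('D_(delta_mx j0 l0) psi (increments g))%:E.
Proof.
move=> spsi i1 i2.
pose dpsi := 'D_(delta_mx j0 l0) psi.
have sdpsi : smooth_poly_growth dpsi by exact: smooth_derive.
have cont f : smooth_poly_growth f -> continuous (f : 'M[R]_(n, d) -> R).
  move=> sf x; apply: differentiable_continuous; exact: smooth_differentiable.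
pose h1 (x : mxT R n d) : \bar R := (psi x * x j0 l0)%:E.
pose h2 (x : mxT R n d) : \bar R := (dpsi x)%:E.
have mh1 : measurable_fun setT h1.
  apply/measurable_EFinP; apply: measurable_funM.
    exact: (continuous_measurable_mx (cont _ spsi)).
  exact: measurable_entry.
have mh2 : measurable_fun setT h2.
  by apply/measurable_EFinP; exact: (continuous_measurable_mx (cont _ sdpsi)).
have mI := measurable_increments.
have mR := measurable_resample.
apply: (integral_scale_same_law mI mR resample_law mh1 mh2 i1 i2) => g ig1 ig2.
pose c := resample (g, 0%R).
pose f x := psi (c + x *: (delta_mx j0 l0 : 'M[R]_(n, d)))%R.
pose f' x := dpsi (c + x *: (delta_mx j0 l0 : 'M[R]_(n, d)))%R.
have h1E x : (h1 (resample (g, x))) = (f x * x)%:E.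
  rewrite /h1 resampleE -/c; congr (_ * _)%:E.
  by rewrite -[X in fun_of_matrix X]resampleE mxE !eqxx.
have h2E x : h2 (resample (g, x)) = (f' x)%:E by rewrite /h2 resampleE.
have dG0 := grid_step_gt0 j0.
under eq_integral do rewrite h1E.
under [in RHS]eq_integral do rewrite h2E.
have sd : (0 < Num.sqrt (grid_step j0))%R by rewrite sqrtr_gt0.
have [C [M [C0 psiC]]] := poly_growth_pos (spsi [::]).2.
rewrite -[X in _ = X%:E * _](sqr_sqrtr (ltW dG0)).
apply: (@gaussian_ibp _ _ sd f f' (C * (1 + `|c|) ^+ M) M).
- move=> x; apply: is_derive_line; apply: diff_derivable.
  exact: smooth_differentiable.
- move=> x; apply: (@continuous_comp _ _ _
    (fun x : R => c + x *: (delta_mx j0 l0 : 'M[R]_(n, d)))%R dpsi).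
    by apply: cvgD; [exact: cvg_cst|apply: cvgZr_tmp; exact: cvg_id].
  exact: cont.
- move=> x; apply: (le_trans (psiC _)); rewrite -mulrA ler_wpM2l// -exprMn.
  rewrite lerXn2r ?nnegrE ?addr_ge0 ?mulr_ge0 ?addr_ge0//.
  have : (`|c + x *: (delta_mx j0 l0 : 'M[R]_(n, d))| <= `|c| + `|x|)%R.
    apply: (le_trans (ler_normD _ _)); rewrite lerD2l normrZ ler_piMr//.
    rewrite [leLHS]/Num.norm /= mx_normrE; apply/bigmax_leP; split=> //= -[j l] _ /=.
    by rewrite mxE; case: (_ && _); rewrite ?normr1 ?normr0.
  have : (0 <= `|c| * `|x|)%R by rewrite mulr_ge0.
  lra.
- by move: ig1; under eq_fun do rewrite h1E.
- by move: ig2; under eq_fun do rewrite h2E.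
Qed.

End resampling.
End wiener_increments.

Section wiener_ibp.
Context (R : realType) (d : nat).
Variables (nu : probability (Omega R d) R) (wiener_nu : is_wiener nu).
Hypothesis iZ : forall F, cylZ F -> nu.-integrable setT (EFin \o F).
Local Notation tval t := (set_val t : R).
Local Open Scope ereal_scope.

(** The increments up to time s add up to the value at time s, and the
    corresponding increment derivatives, weighted with the lengths of the steps,
    to the derivative in the direction min(., s). *)
Lemma wiener_ibp (F : Omega R d -> R) (s : unit_interval R) (l : 'I_d) :
  cylZ F -> (0 < tval s)%R ->
  \int[nu]_g (dirD F (tval s) l g)%:E =
  \int[nu]_g (F g * path_at g s ord0 l)%:E.
Proof.
move=> ZF s0.
have s01 : (0 < tval s <= 1)%R by rewrite s0; case/andP: (time_bounds s).
have [k [T [f [_ [q [gT sf _ Tq [FE _]]]]]]] := cylZ_common_grid ZF ZF s01.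
have {Tq} Tq : T q = s by exact: time_inj.
pose psi x := f (cumul R k *m x).
have spsi : smooth_poly_growth psi by exact: smooth_mulmx.
have psiE g : psi (increments T g) = F g by rewrite /psi -sample_increments// FE.
pose h (j : 'I_k.+1) (g : Omega R d) : R := 'D_(delta_mx j l) psi (increments T g).
have hE j g : h j g = (\sum_(i < k.+1) ((j <= i)%N)%:R * 'D_(delta_mx i l) f (sample T g))%R.
  rewrite /h derive_mulmx; last exact: smooth_differentiable.
  by rewrite sample_increments//; apply: eq_bigr => i _; rewrite mxE.
have Zh j : cylZ (h j).
  rewrite (funext (hE j)); apply: (@cylZ_sample _ _ _ _
    (fun x => \sum_(i < k.+1) ((j <= i)%N)%:R * 'D_(delta_mx i l) f x)%R gT).
  apply: smooth_sum => i; apply: smoothM; first exact: smooth_cst.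
  exact: smooth_derive.
have ZV (j : 'I_k.+1) : cylZ (fun g => F g * increments T g j l)%R.
  apply: cylZM => //; under eq_fun do rewrite mxE.
  by apply: cylZB; exact: cylZ_coord.
pose D (j : 'I_k.+1) := grid_step T j.
have -> : \int[nu]_g (dirD F (tval s) l g)%:E =
    \int[nu]_g \sum_(j < k.+1 | (j <= q)%N) (D j)%:E * (h j g)%:E.
  apply: eq_integral => g _.
  have [s0' _] := andP s01.
  rewrite /dirD FE grad_sample//; last exact: ltW.
  under [RHS]eq_bigr do rewrite -EFinM; rewrite sumEFin; congr EFin.
  under [RHS]eq_bigr do rewrite hE mulr_sumr.
  rewrite exchange_big/=; apply: eq_bigr => i _.
  under eq_bigr do rewrite mulrA; rewrite -mulr_suml; congr (_ * _)%R.
  rewrite -Tq; have [T0 Tlt _] := gT.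
  (* Both sides are the sum of the steps up to the smaller of the two times. *)
  transitivity (\sum_(j < k.+1 | (j <= minn q i)%N) D j)%R.
    rewrite (_ : minn q i = if (q <= i)%N then q : nat else i); last first.
      by rewrite /minn; case: ltngtP.
    case: leqP => [qi|/ltnW iq]; rewrite sum_grid_step//.
      rewrite min_r//; move: qi; rewrite leq_eqVlt => /orP[/eqP qi|qi].
        by rewrite (val_inj qi : q = i).
      exact/ltW/Tlt.
    rewrite min_l//; move: iq; rewrite leq_eqVlt => /orP[/eqP iq|iq].
      by rewrite (val_inj iq : i = q).
    exact/ltW/Tlt.
  rewrite big_mkcond [RHS]big_mkcond; apply: eq_bigr => j _.
  by rewrite leq_min; case: (j <= q)%N; case: (j <= i)%N; rewrite ?mulr1 ?mulr0.
have -> : \int[nu]_g (F g * path_at g s ord0 l)%:E =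
    \int[nu]_g \sum_(j < k.+1 | (j <= q)%N) (F g * increments T g j l)%:E.
  apply: eq_integral => g _; rewrite sumEFin; congr EFin.
  rewrite -mulr_sumr; congr (_ * _)%R.
  transitivity (sample T g q l); first by rewrite mxE Tq.
  rewrite sample_increments// mxE [RHS]big_mkcond; apply: eq_bigr => j _.
  by rewrite mxE; case: ifP; rewrite ?mul1r ?mul0r.
under eq_integral do rewrite big_mkcond.
under [RHS]eq_integral do rewrite big_mkcond.
have iDh (j : 'I_k.+1) : nu.-integrable setT
    (fun g => if (j <= q)%N then (D j)%:E * (h j g)%:E else 0).
  case: (j <= q)%N; last exact: integrable0.
  by apply: integrableZl => //; exact: (iZ (Zh j)).
have iV (j : 'I_k.+1) : nu.-integrable setT
    (fun g => if (j <= q)%N then (F g * increments T g j l)%:E else 0).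
  by case: (j <= q)%N; [exact: (iZ (ZV j))|exact: integrable0].
rewrite !integral_sum//; apply: eq_bigr => j _; case: (j <= q)%N => //.
rewrite integralZl//; last exact: (iZ (Zh j)).
rewrite /D -(increment_ibp wiener_nu gT spsi); last 2 first.
- by under eq_fun do rewrite psiE; exact: (iZ (ZV j)).
- exact: (iZ (Zh j)).
by apply: eq_integral => g _; rewrite psiE.
Qed.

(** The previous identity for the product F * G, by the Leibniz rule. *)
Lemma wiener_ibp2 (F G : Omega R d -> R) (s : unit_interval R) (l : 'I_d) :
  cylZ F -> cylZ G -> (0 < tval s)%R ->
  \int[nu]_g (dirD F (tval s) l g * G g)%:E =
  \int[nu]_g (F g * (G g * path_at g s ord0 l - dirD G (tval s) l g))%:E.
Proof.
move=> ZF ZG s0; have ZFG := cylZM ZF ZG.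
have ibp := wiener_ibp l ZFG s0.
have sge := ltW s0.
have ZDF := cylZ_dirD l ZF sge; have ZDG := cylZ_dirD l ZG sge.
have i1 := iZ (cylZM ZDF ZG).
have i2 := iZ (cylZM ZF ZDG).
have i3 := iZ (cylZM ZFG (cylZ_coord s l)).
have -> : \int[nu]_g (F g * (G g * path_at g s ord0 l - dirD G (tval s) l g))%:E =
    \int[nu]_g (F g * G g * path_at g s ord0 l)%:E - \int[nu]_g (F g * dirD G (tval s) l g)%:E.
  by rewrite -integralB//; apply: eq_integral => g _; rewrite -EFinB mulrBr mulrA.
rewrite -ibp -integralB//; last exact: (iZ (cylZ_dirD l ZFG sge)).
apply: eq_integral => g _; rewrite -EFinB; congr EFin.
by rewrite dirDM// addrAC subrr add0r mulrC.
Qed.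

End wiener_ibp.

(** * Integrable functions orthogonal to the cylindrical functions *)

Lemma measurable_cylZ (R : realType) (d : nat) (F : Omega R d -> R) :
  cylZ F -> measurable_fun setT F.
Proof.
move=> [c _ <-].
have mS : measurable_fun setT (@cyl_sample R d c : _ -> mxT R (cyl_size c).+1 d).
  apply: measurable_mxT => i l; under eq_fun do rewrite mxE.
  exact: measurable_path_at.
have cf : continuous (cyl_base c).
  move=> x; apply: differentiable_continuous.
  exact: smooth_differentiable (cyl_base_smooth c).
exact: (measurableT_comp (continuous_measurable_mx cf) mS).
Qed.

Section cylindrical_total.
Context (R : realType) (d : nat).
Local Notation Om := (Omega R d).
Local Notation code := (seq (unit_interval R * 'I_d * R)).

Definition threshold_set (L : code) : set Om :=
  [set g | all (fun p => p.2 < path_at g p.1.1 ord0 p.1.2) L].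

Definition threshold_sets : set (set Om) := range threshold_set.

Lemma threshold_setsT : threshold_sets setT.
Proof. by exists [::] => //; apply/seteqP; split. Qed.

Lemma threshold_setsI : setI_closed threshold_sets.
Proof.
move=> _ _ [L _ <-] [L' _ <-]; exists (L ++ L') => //.
by apply/seteqP; split=> g; rewrite /threshold_set /= all_cat => /andP.
Qed.

Lemma measurable_threshold_set L : measurable (threshold_set L).
Proof.
elim: L => [|p L IH].
  by rewrite (_ : threshold_set _ = setT)//; apply/seteqP; split.
rewrite (_ : threshold_set _ =
    [set g | `]p.2, +oo[%classic (path_at g p.1.1 ord0 p.1.2)] `&` threshold_set L).
  apply: measurableI => //; rewrite -[X in measurable X]setTI.
  by apply: (@measurable_path_at R d p.1.1 p.1.2) => //; exact: measurable_itv.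
by apply/seteqP; split=> g; rewrite /threshold_set/= in_itv/= andbT => /andP.
Qed.

Lemma threshold_sets_generate : measurable = <<s threshold_sets>>.
Proof.
apply/seteqP; split; last first.
  apply: smallest_sub; first exact: sigma_algebra_measurable.
  by move=> _ [L _ <-]; exact: measurable_threshold_set.
apply: smallest_sub; first exact: smallest_sigma_algebra.
move=> _ [t [l [B mB ->]]].
pose S := g_sigma_algebraType threshold_sets.
have : measurable_fun setT (fun g : S => path_at g t ord0 l).
  apply: (measurability _ (RGenOInfty.measurableE R)) => _ [_ [a ->] <-].
  apply: sub_sigma_algebra; exists [:: (t, l, a)] => //.
  apply/seteqP; split=> g; rewrite /threshold_set /= in_itv/= !andbT//.
  by move=> [].
by move=> /(_ measurableT B mB); rewrite setTI.
Qed.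

(** A cylindrical function which, as n grows, increasingly resembles the
    indicator of the threshold set: each factor is the logistic function of
    n^2 (g_l(t) - a) - n. *)
Definition soft_threshold (L : code) (n : nat) (g : Om) : R :=
  \prod_(p <- L) logistic (n%:R ^+ 2 * path_at g p.1.1 ord0 p.1.2 +
                            (- (n%:R ^+ 2 * p.2) - n%:R)).

Lemma cylZ_soft_threshold L n : cylZ (soft_threshold L n).
Proof.
rewrite /soft_threshold; elim: L => [|p L IH].
  by under eq_fun do rewrite big_nil; exact: cylZ_cst.
under eq_fun do rewrite big_cons.
by apply: cylZM => //; exact: cylZ_logistic.
Qed.

Lemma soft_threshold_bounds L n g : 0 <= soft_threshold L n g <= 1.
Proof.
apply/andP; split; first by apply: prodr_ge0 => p _; exact: logistic_ge0.
rewrite /soft_threshold; elim: L => [|p L IH]; first by rewrite big_nil.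
rewrite big_cons mulr_ile1// ?logistic_ge0 ?logistic_le1//.
by apply: prodr_ge0 => q _; exact: logistic_ge0.
Qed.

Lemma logistic_opp_le (v : R) (n : nat) : n%:R <= v -> logistic (- v) <= n.+1%:R^-1.
Proof.
move=> nv; rewrite /logistic opprK lef_pV2 ?posrE ?ltr0n ?addr_gt0 ?expR_gt0//.
have := expR_ge1Dx v; rewrite -natr1; lra.
Qed.

Lemma logisticN (v : R) : logistic (- v) = 1 - logistic v.
Proof.
rewrite /logistic opprK.
have e0 : 0 < expR v := expR_gt0 v.
rewrite expRN; field.
by rewrite !gt_eqF// addr_gt0.
Qed.

(** The offset n makes the limit vanish at the threshold itself. *)
Lemma logistic_cvg (y : R) :
  logistic (n%:R ^+ 2 * y - n%:R) @[n --> \oo] --> ((0 < y)%R%:R : R).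
Proof.
have [y0|y0] := ltP 0 y.
- apply/cvgrPdist_le => e e0; near=> n.
  rewrite -logisticN ger0_norm ?logistic_ge0//.
  apply: (@le_trans _ _ n.+1%:R^-1).
    apply: logistic_opp_le.
    have n2 : 2 / y <= n%:R by near: n; exact: nbhs_infty_ger.
    have : 2 <= n%:R * y by rewrite -ler_pdivrMr.
    have : 0 <= n%:R :> R by [].
    nra.
  by apply/ltW; near: n; exact: (near_infty_natSinv_lt (PosNum e0)).
- apply/cvgrPdist_le => e e0; near=> n.
  rewrite sub0r normrN ger0_norm ?logistic_ge0//.
  apply: (@le_trans _ _ n.+1%:R^-1).
    rewrite -[X in logistic X]opprK; apply: logistic_opp_le.
    have : 0 <= n%:R ^+ 2 :> R by rewrite sqr_ge0.
    nra.
  by apply/ltW; near: n; exact: (near_infty_natSinv_lt (PosNum e0)).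
Unshelve. all: by end_near. Qed.

Lemma soft_threshold_cvg L g :
  soft_threshold L n g @[n --> \oo] --> (\1_(threshold_set L) g : R).
Proof.
rewrite indicE.
have -> : g \in threshold_set L = all (fun p => p.2 < path_at g p.1.1 ord0 p.1.2) L.
  by apply/idP/idP; rewrite inE.
rewrite /soft_threshold; elim: L => [|p L IH] /=.
  by under eq_fun do rewrite big_nil; exact: cvg_cst.
under eq_fun do rewrite big_cons.
rewrite -mulnb natrM; apply: cvgM => //.
have := @logistic_cvg (path_at g p.1.1 ord0 p.1.2 - p.2).
rewrite subr_gt0; apply: cvg_trans; apply: near_eq_cvg; near=> n.
by rewrite mulrBr addrA.
Unshelve. all: by end_near. Qed.

Variables (nu : probability Om R) (X : Om -> R).
Hypothesis iX : nu.-integrable setT (EFin \o X).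
Hypothesis X0 : forall G, cylZ G -> (forall g, 0 <= G g <= 1) ->
  (\int[nu]_g (X g * G g)%:E = 0)%E.

(** The hypothesis passes from soft thresholds to the indicators of threshold
    sets by dominated convergence. *)
Lemma cylZ_total : ae_eq nu setT (EFin \o X) (cst 0%E).
Proof.
apply: (integral0_pi_system_ae threshold_sets_generate threshold_setsI
  threshold_setsT iX) => _ [L _ <-].
have mA := measurable_threshold_set L.
have mX : measurable_fun setT (EFin \o X) by exact: measurable_int iX.
have mXr : measurable_fun setT X by exact/measurable_EFinP.
pose f_ n g := (X g * soft_threshold L n g)%:E.
pose f g := (X g * \1_(threshold_set L) g)%:E.
have cf g : f_ n g @[n --> \oo] --> f g.
  apply: cvg_EFin; first by near=> n.
  by apply: cvgMr; exact: soft_threshold_cvg.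
have mst n : measurable_fun setT (soft_threshold L n).
  exact: (measurable_cylZ (cylZ_soft_threshold L n)).
have mf_ n : measurable_fun setT (f_ n).
  by apply/measurable_EFinP; exact: measurable_funM.
have mf : measurable_fun setT f.
  by apply/measurable_EFinP; exact: measurable_funM.
have f_X : {ae nu, forall g n, setT g -> (`|f_ n g| <= (abse \o (EFin \o X)) g)%E}.
  apply: aeW => g n _ /=; rewrite lee_fin normrM ler_piMr//.
  by have /andP[s0 s1] := soft_threshold_bounds L n g; rewrite ger0_norm.
have [_ _] := @dominated_convergence _ _ _ nu setT measurableT f_ f
  (abse \o (EFin \o X)) mf_ mf (aeW _ (fun g _ => cf g)) (integrable_abse iX) f_X.
have -> : [sequence (\int[nu]_g f_ n g)%E]_n = fun=> 0%E.
  apply/funext => n; apply: X0; first exact: cylZ_soft_threshold.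
  exact: soft_threshold_bounds.
move=> /(cvg_lim (@ereal_hausdorff R)); rewrite lim_cst// => I0.
rewrite integral_mkcond I0; apply: eq_integral => g _.
rewrite patchE /f indicE; case: ifP => _; first by rewrite mulr1.
by rewrite mulr0.
Unshelve. all: by end_near. Qed.

End cylindrical_total.

(** * The inner product of the Cameron-Martin space *)

Section L2_unit_interval.
Context (R : realType) (d : nat).
Local Notation mu := (@lebesgue_measure R).
Local Notation I01 := (`[0, 1]%classic : set R).
Implicit Types a b c : R -> 'rV[R]_d.

Let mI : measurable I01. Proof. exact: measurable_itv. Qed.

Definition L2_01 : set (R -> 'rV[R]_d) :=
  [set a : R -> 'rV[R]_d | forall l, measurable_fun I01 (fun x => a x ord0 l) /\
     (\int[mu]_(x in I01) ((a x ord0 l) ^+ 2)%:E < +oo)%E].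

(** Hdot f g is ip applied to the derivatives of f and g, which may be replaced
    by explicit functions that agree with them almost everywhere. *)
Definition ip a b : R :=
  \int[mu]_(x in I01) \sum_(l < d) a x ord0 l * b x ord0 l.

Lemma L2_comp_integrable a b l : L2_01 a -> L2_01 b ->
  mu.-integrable I01 (fun x => (a x ord0 l * b x ord0 l)%:E).
Proof.
move=> /(_ l)[ma ia] /(_ l)[mb ib].
have ma2 : measurable_fun I01 (fun x => ((a x ord0 l) ^+ 2)%:E).
  by apply/measurable_EFinP; exact: measurable_funX.
have mb2 : measurable_fun I01 (fun x => ((b x ord0 l) ^+ 2)%:E).
  by apply/measurable_EFinP; exact: measurable_funX.
apply/integrableP; split; first by apply/measurable_EFinP; exact: measurable_funM.
apply: (@le_lt_trans _ _ (\int[mu]_(x in I01) (((a x ord0 l) ^+ 2)%:E +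
    ((b x ord0 l) ^+ 2)%:E))%E).
  apply: ge0_le_integral => //.
  - by apply/measurable_EFinP/measurableT_comp => //; exact: measurable_funM.
  - exact: emeasurable_funD.
  - move=> x _; rewrite -EFinD lee_fin normrM.
    rewrite -[X in _ <= X + _]real_normK ?num_real//.
    rewrite -[X in _ <= _ + X]real_normK ?num_real//.
    have := sqr_ge0 (`|a x ord0 l| - `|b x ord0 l|).
    have := normr_ge0 (a x ord0 l); have := normr_ge0 (b x ord0 l).
    nra.
rewrite ge0_integralD//; first by rewrite lte_add_pinfty.
- by move=> x _; rewrite lee_fin sqr_ge0.
- by move=> x _; rewrite lee_fin sqr_ge0.
Qed.

Lemma L2_ip_integrable a b : L2_01 a -> L2_01 b ->
  mu.-integrable I01 (EFin \o (fun x => \sum_(l < d) a x ord0 l * b x ord0 l)).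
Proof.
move=> La Lb; rewrite (_ : _ \o _ =
    fun x => (\sum_(l < d) (a x ord0 l * b x ord0 l)%:E)%E); last first.
  by apply/funext => x; rewrite sumEFin.
by apply: integrable_sum => // l _; exact: L2_comp_integrable.
Qed.

Lemma ipC a b : ip a b = ip b a.
Proof. by rewrite /ip; under eq_Rintegral do under eq_bigr do rewrite mulrC. Qed.

Lemma ip_ge0 a : 0 <= ip a a.
Proof.
by apply: Rintegral_ge0 => x _; apply: sumr_ge0 => l _; rewrite -expr2 sqr_ge0.
Qed.

Lemma L2Z k a : L2_01 a -> L2_01 (fun x => k *: a x).
Proof.
move=> La l; have [ma ia] := La l; split.
  rewrite (_ : (fun x => _) = fun x => k * a x ord0 l).
    exact: measurable_funM.
  by apply/funext => x; rewrite mxE.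
under eq_integral do rewrite mxE exprMn EFinM.
rewrite ge0_integralZl_EFin ?sqr_ge0//.
- by rewrite lte_mul_pinfty ?lee_fin ?sqr_ge0.
- by move=> x _; rewrite lee_fin sqr_ge0.
- by apply/measurable_EFinP; exact: measurable_funX.
Qed.

Lemma L2D a b : L2_01 a -> L2_01 b -> L2_01 (fun x => a x + b x).
Proof.
move=> La Lb l; have [ma ia] := La l; have [mb ib] := Lb l; split.
  rewrite (_ : (fun x => _) = fun x => a x ord0 l + b x ord0 l).
    exact: measurable_funD.
  by apply/funext => x; rewrite mxE.
have iab : mu.-integrable I01 (fun x => (a x ord0 l * a x ord0 l)%:E +
    ((b x ord0 l * b x ord0 l)%:E + (2%:E * (a x ord0 l * b x ord0 l)%:E)))%E.
  apply: integrableD => //; first exact: L2_comp_integrable.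
  apply: integrableD => //; first exact: L2_comp_integrable.
  by apply: integrableZl => //; exact: L2_comp_integrable.
have /integrableP[_] := iab; apply: le_lt_trans.
rewrite le_eqVlt; apply/orP; left; apply/eqP; apply: eq_integral => x _.
rewrite -!EFinM -!EFinD mxE gee0_abs; first by congr EFin; ring.
rewrite lee_fin; have := sqr_ge0 (a x ord0 l + b x ord0 l); lra.
Qed.

Lemma ipDl a b c : L2_01 a -> L2_01 b -> L2_01 c ->
  ip (fun x => a x + b x) c = ip a c + ip b c.
Proof.
move=> La Lb Lc; rewrite /ip -RintegralD//; last 2 first.
- exact: L2_ip_integrable.
- exact: L2_ip_integrable.
apply: eq_Rintegral => x _; rewrite -big_split/=; apply: eq_bigr => l _.
by rewrite mxE mulrDl.
Qed.

Lemma ipZl k a b : L2_01 a -> L2_01 b -> ip (fun x => k *: a x) b = k * ip a b.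
Proof.
move=> La Lb; rewrite /ip -RintegralZl//; last exact: L2_ip_integrable.
apply: eq_Rintegral => x _; rewrite mulr_sumr; apply: eq_bigr => l _.
by rewrite mxE mulrA.
Qed.

Lemma L2_0 : L2_01 (fun=> 0).
Proof.
move=> l; split; first exact: measurable_cst.
rewrite (eq_integral (cst 0%E)) ?integral0// => x _.
by rewrite mxE expr0n.
Qed.

Lemma ip0l a : ip (fun=> 0) a = 0.
Proof.
rewrite /ip (@eq_Rintegral _ _ _ mu I01 (fun=> 0)); last first.
  by move=> x _; rewrite big1// => l _; rewrite mxE mul0r.
by rewrite /Rintegral integral0.
Qed.

Lemma L2_sum (I : Type) (r : seq I) (k : I -> R) (a : I -> R -> 'rV[R]_d) :
  (forall i, L2_01 (a i)) -> L2_01 (fun x => \sum_(i <- r) k i *: a i x).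
Proof.
move=> La; elim: r => [|i r IH].
  by under eq_fun do rewrite big_nil; exact: L2_0.
by under eq_fun do rewrite big_cons; apply: L2D => //; exact: L2Z.
Qed.

Lemma ip_suml (I : Type) (r : seq I) (k : I -> R) (a : I -> R -> 'rV[R]_d) b :
  (forall i, L2_01 (a i)) -> L2_01 b ->
  ip (fun x => \sum_(i <- r) k i *: a i x) b = \sum_(i <- r) k i * ip (a i) b.
Proof.
move=> La Lb; elim: r => [|i r IH].
  by under eq_fun do rewrite big_nil; rewrite ip0l big_nil.
under eq_fun do rewrite big_cons.
by rewrite ipDl ?ipZl ?IH ?big_cons//; [exact: L2Z|exact: L2_sum].
Qed.

Lemma ip_lincomb a b (s : R) : L2_01 a -> L2_01 b ->
  ip (fun x => a x + s *: b x) (fun x => a x + s *: b x) =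
  ip a a + 2 * s * ip a b + s ^+ 2 * ip b b.
Proof.
move=> La Lb; have Lsb := L2Z s Lb; have Lab := L2D La Lsb.
rewrite ipDl// ipZl// !(ipC _ (fun x => a x + _)) !ipDl// !ipZl// (ipC b a).
ring.
Qed.

(** Minimizing the norm of a + s b over s; if b has norm 0 the same expression
    would become negative for some s unless ip a b vanishes. *)
Lemma ip_CS a b : L2_01 a -> L2_01 b ->
  `|ip a b| <= Num.sqrt (ip a a) * Num.sqrt (ip b b).
Proof.
move=> La Lb; rewrite -sqrtrM ?ip_ge0// -sqrtr_sqr ler_wsqrtr//.
have [b0|bn0] := eqVneq (ip b b) 0.
  rewrite b0 mulr0; have [->|abn0] := eqVneq (ip a b) 0; first by rewrite expr0n.
  have := ip_ge0 (fun x => a x + (- (ip a a + 1) / (2 * ip a b)) *: b x).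
  rewrite ip_lincomb// b0 mulr0 addr0.
  rewrite (_ : 2 * _ * _ = - (ip a a + 1)); last by field.
  lra.
have b0 : 0 < ip b b by rewrite lt_def bn0 ip_ge0.
have := ip_ge0 (fun x => a x + (- (ip a b / ip b b)) *: b x).
rewrite ip_lincomb//.
rewrite (_ : _ + _ + _ = (ip a a * ip b b - ip a b ^+ 2) / ip b b); last by field.
by rewrite pmulr_lge0 ?invr_gt0// subr_ge0.
Qed.

End L2_unit_interval.

Section integral_ae_nonmeasurable.
Context dd (T : measurableType dd) (R : realType) (mu : {measure set T -> \bar R}).
Local Open Scope ereal_scope.

Let le_off_null (f g : T -> \bar R) (N : set T) :
  measurable N -> mu N = 0 -> (forall x, 0 <= f x) -> (forall x, 0 <= g x) ->
  (forall x, ~ N x -> f x <= g x) -> \int[mu]_x f x <= \int[mu]_x g x.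
Proof.
move=> mN N0 f0 g0 fg; rewrite (ge0_integralTE mu f0).
apply: ge_ereal_sup => _ [h hf <-].
have mNC : measurable (~` N) by exact: measurableC.
pose h' := mul_nnsfun h (indic_nnsfun R mNC).
have h'E x : h' x = (h x * \1_(~` N) x)%R by [].
have -> : sintegral mu h = \int[mu]_x (h' x)%:E.
  have -> : sintegral mu h = \int[mu]_x (h x)%:E.
    by rewrite (integral_nnsfun _ measurableT) patch_setT.
  apply: ge0_ae_eq_integral => //.
  - exact/measurable_EFinP.
  - exact/measurable_EFinP.
  - by move=> x _; rewrite lee_fin.
  - by move=> x _; rewrite lee_fin.
  exists N; split=> // x /= H; apply: contrapT => Nx; apply: H => _.
  apply/esym; rewrite [LHS](_ : _ = (h x * \1_(~` N) x)%:E)//.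
  by rewrite indicE mem_set// mulr1.
rewrite (integral_nnsfun _ measurableT) patch_setT (ge0_integralTE mu g0).
apply: ereal_sup_ubound; exists h' => // x.
rewrite [leLHS](_ : _ = (h x * \1_(~` N) x)%:E)// indicE.
have [Nx|Nx] := pselect (N x).
  by rewrite memNset// mulr0.
by rewrite mem_set// mulr1; exact: le_trans (hf x) (fg x Nx).
Qed.

(** The integral is a supremum over the simple functions below the integrand, and
    these can be cut off on the null set. This covers the function derive1 f,
    whose behaviour on the null set is arbitrary. *)
Lemma ge0_integral_eq_off_null (D : set T) (f g : T -> \bar R) (N : set T) :
  measurable N -> mu N = 0 -> (forall x, 0 <= f x) -> (forall x, 0 <= g x) ->
  (forall x, D x -> ~ N x -> f x = g x) ->
  \int[mu]_(x in D) f x = \int[mu]_(x in D) g x.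
Proof.
move=> mN N0 f0 g0 fg; rewrite integral_mkcond [RHS]integral_mkcond.
have fgD x : ~ N x -> (f \_ D) x = (g \_ D) x.
  by move=> Nx; rewrite !patchE; case: ifPn => // /set_mem Dx; exact: fg.
apply/eqP; rewrite eq_le; apply/andP; split; apply: (le_off_null mN) => //.
all: try (by move=> x; apply: erestrict_ge0 => y _).
- by move=> x Nx; rewrite fgD//; exact: lexx.
- by move=> x Nx; rewrite fgD//; exact: lexx.
Qed.

End integral_ae_nonmeasurable.

Section weak_derivative.
Context (R : realType) (d : nat).
Local Notation mu := (@lebesgue_measure R).
Local Notation I01 := (`[0, 1]%classic : set R).
Implicit Types f g a b : R -> 'rV[R]_d.

Definition ae_derivative f a : Prop :=
  L2_01 a /\ exists N : set R, [/\ measurable N, mu N = 0%E &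
    forall x, I01 x -> ~ N x -> is_derive x 1 f (a x)].

Lemma ae_derivativeB f g a b : ae_derivative f a -> ae_derivative g b ->
  ae_derivative (f - g) (fun x => a x + (-1) *: b x).
Proof.
move=> [La [N [mN N0 fN]]] [Lb [M [mM M0 gM]]]; split.
  exact: (L2D La (L2Z (-1) Lb)).
exists (N `|` M); split; first exact: measurableU.
  by rewrite measureU0.
move=> x Ix /not_orP[Nx Mx]; rewrite scaleN1r.
by have := fN x Ix Nx; have := gM x Ix Mx => dg df; exact: is_deriveB.
Qed.

Lemma Hdot_self f a : ae_derivative f a -> Hdot f f = ip a a.
Proof.
move=> [La [N [mN N0 fN]]]; rewrite /Hdot /ip /Rintegral; congr fine.
apply: (@ge0_integral_eq_off_null _ (measurableTypeR R) R mu I01 _ _ N mN N0).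
- by move=> x; rewrite lee_fin; apply: sumr_ge0 => l _; rewrite -expr2 sqr_ge0.
- by move=> x; rewrite lee_fin; apply: sumr_ge0 => l _; rewrite -expr2 sqr_ge0.
move=> x Ix Nx; congr EFin; apply: eq_bigr => l _.
have dx := fN x Ix Nx.
by rewrite !derive1E derive_val.
Qed.

Lemma cameron_martin_derivative f : cameron_martin f ->
  ae_derivative f (derive1 f).
Proof.
move=> [_ _ [N [mN N0 fN]] mf f2]; split.
  move=> l; split; first exact: mf.
  apply: le_lt_trans f2; apply: ge0_le_integral => //.
  - by move=> x _; rewrite lee_fin sqr_ge0.
  - by apply/measurable_EFinP; exact: (measurable_funX 2 (mf l)).
  - apply/measurable_EFinP; apply: measurable_sum => k.
    exact: (measurable_funX 2 (mf k)).
  - move=> x _; rewrite lee_fin (bigD1 l)//= lerDl.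
    by apply: sumr_ge0 => k _; rewrite sqr_ge0.
exists N; split; [exact: mN|exact: N0|move=> x Ix Nx].
rewrite derive1E; apply: derivableP.
by apply: contrapT => H; apply: Nx; apply: fN => /(_ Ix).
Qed.

(** Outside the null set {0} equality on [0, +oo) is equality near the point. *)
Lemma ae_derivative_congr f g a : (forall s, 0 <= s -> f s = g s) ->
  ae_derivative f a -> ae_derivative g a.
Proof.
move=> fg [La [N [mN N0 fN]]]; split=> //.
exists (N `|` [set 0]); split.
- by apply: measurableU => //; exact: measurable_set1.
- by rewrite measureU0//; exact: lebesgue_measure_set1.
move=> x Ix /not_orP[Nx x0]; have := fN x Ix Nx.
have x_gt0 : 0 < x.
  by move: Ix; rewrite /= in_itv/= lt_def => /andP[-> _]; rewrite andbT; exact/eqP.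
apply: near_eq_is_derive; near=> s; apply: fg; apply: ltW.
by near: s; exact: lt_nbhsr.
Unshelve. all: by end_near. Qed.

(** The reproducing element of the evaluation of the l-th coordinate at t. *)
Definition kern (t : R) (l : 'I_d) (s : R) : 'rV[R]_d :=
  Num.min t s *: delta_mx ord0 l.

Definition dkern (t : R) (l : 'I_d) (x : R) : 'rV[R]_d :=
  (x < t)%R%:R *: delta_mx ord0 l.

Lemma is_derive_kern t l (x : R) : x != t ->
  is_derive x 1 (kern t l) (dkern t l x).
Proof.
move=> xt; rewrite /dkern; have [x_lt|x_gt] := ltP x t.
- rewrite scale1r.
  have e : is_derive x 1 (fun s : R => s *: (delta_mx ord0 l : 'rV[R]_d)) (delta_mx ord0 l).
    have dx : differentiable (fun s : R => s *: (delta_mx ord0 l : 'rV[R]_d)) x.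
      by [].
    apply: DeriveDef; first exact/derivable1_diffP.
    by rewrite deriveE// diff_val scale1r.
  apply: near_eq_is_derive e; near=> s; rewrite /kern min_r//; apply: ltW.
  by near: s; exact: lt_nbhsl.
- rewrite scale0r.
  apply: (@near_eq_is_derive _ _ _ (cst (t *: (delta_mx ord0 l : 'rV[R]_d)))).
  near=> s; rewrite /kern min_l//; apply: ltW.
  by near: s; apply: lt_nbhsr; rewrite lt_def xt.
Unshelve. all: by end_near. Qed.

Lemma L2_dkern t l : L2_01 (dkern t l).
Proof.
have E (x : R) m : dkern t l x ord0 m = (m == l)%:R * \1_(`]-oo, t[%classic) x.
  by rewrite !mxE eqxx indicE mem_setE in_itv/= mulrC.
move=> m.
have mE : measurable_fun I01 (fun x => dkern t l x ord0 m).
  rewrite (_ : (fun x => _) = fun x => (m == l)%:R * \1_(`]-oo, t[%classic) x).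
    by apply: measurable_funM => //; exact: measurable_indic.
  by apply/funext => x; exact: E.
split=> //.
apply: (@le_lt_trans _ _ (\int[mu]_(x in I01) 1)%E).
  apply: ge0_le_integral => //.
  - by move=> x _; rewrite lee_fin sqr_ge0.
  - by apply/measurable_EFinP; exact: (measurable_funX 2 mE).
  - move=> x _; rewrite lee_fin E indicE.
    by case: (_ == _); case: (_ \in _); rewrite ?mul1r ?mul0r ?expr1n ?expr0n/= ?ler01.
by rewrite integral_cst// mul1e /= lebesgue_measure_itv/= lte01 oppr0 adde0 ltry.
Qed.

Lemma ip_dkern t s l m : 0 <= t <= 1 -> 0 <= s <= 1 ->
  ip (dkern t l) (dkern s m) = Num.min t s * (l == m)%:R.
Proof.
move=> /andP[t0 t1] /andP[s0 s1]; set r := Num.min t s.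
have r01 : 0 <= r <= 1 by rewrite le_min t0 s0 ge_min t1.
rewrite /ip (@eq_Rintegral _ _ _ mu I01
    (fun x => (l == m)%:R * \1_(`]-oo, r[%classic) x)); last first.
  move=> x _; rewrite indicE mem_setE in_itv/= lt_min.
  have [<-{m}|lm] := eqVneq l m.
    rewrite (bigD1 l)//= big1 ?addr0; last first.
      by move=> k kl; rewrite !mxE (negbTE kl) !mulr0.
    rewrite !mxE !eqxx !mulr1 mul1r.
    by case: (x < t); case: (x < s); rewrite /= ?mulr1 ?mulr0.
  rewrite mul0r big1// => k _; rewrite !mxE !eqxx/=.
  have [->|kl] := eqVneq k l; first by rewrite (negbTE lm) mulr0 mulr0.
  by rewrite mulr0 mul0r.
have mr : measurable (`]-oo, r[%classic : set R) by exact: measurable_itv.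
have mI : measurable I01 by exact: measurable_itv.
rewrite mulrC /Rintegral.
under eq_integral do rewrite EFinM.
rewrite ge0_integralZl_EFin//; last first.
  by apply/measurable_EFinP; exact: measurable_indic.
rewrite integral_indic//= (_ : _ `&` _ = `[0, r[%classic); last first.
  apply/seteqP; split=> x /=; rewrite !in_itv/=.
    by move=> [-> /andP[-> _]].
  by move=> /andP[-> xr]; rewrite xr (le_trans (ltW xr))//; case/andP: r01.
rewrite lebesgue_measure_itv/= lte_fin; case: ltP => [_|r0].
  by rewrite -EFinD subr0 -EFinM/= mulrC.
rewrite mule0/=; have -> : r = 0 by apply/eqP; rewrite eq_le r0; case/andP: r01.
by rewrite mulr0.
Qed.

End weak_derivative.

(** * Gradients of cylindrical functions *)

Section gradient_energy.
Context (R : realType) (d : nat).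
Local Notation mu := (@lebesgue_measure R).
Local Notation I01 := (`[0, 1]%classic : set R).
Implicit Types (F G : Omega R d -> R) (g : Omega R d).

Definition energy F g : R := Hdot (grad F g) (grad F g).

Definition lincomb_dkern (I : finType) (t : I -> R) (l : I -> 'I_d)
    (c : I -> R) (x : R) : 'rV[R]_d :=
  \sum_i c i *: dkern (t i) (l i) x.

Lemma L2_lincomb_dkern (I : finType) (t : I -> R) (l : I -> 'I_d) (c : I -> R) :
  L2_01 (lincomb_dkern t l c).
Proof. by apply: L2_sum => i; exact: L2_dkern. Qed.

Lemma ip_lincomb_dkern (I : finType) (t : I -> R) (l : I -> 'I_d) (c : I -> R) b :
  L2_01 b ->
  ip (lincomb_dkern t l c) b = \sum_i c i * ip (dkern (t i) (l i)) b.
Proof.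
move=> Lb.
rewrite -(ip_suml (index_enum I) c (a := fun i => dkern (t i) (l i)))//.
by move=> i; exact: L2_dkern.
Qed.

(** By definition a gradient is a combination of reproducing elements whose
    coefficients, the partial derivatives, are cylindrical. *)
Definition grad_decomposition F (I : finType) (t : I -> R) (l : I -> 'I_d)
    (c : I -> Omega R d -> R) : Prop :=
  [/\ forall i, 0 < t i <= 1, forall i, cylZ (c i) &
     forall g s, 0 <= s -> grad F g s = \sum_i c i g *: kern (t i) (l i) s].

Lemma grad_decomp F : cylZ F ->
  exists (I : finType) (t : I -> R) (l : I -> 'I_d) (c : I -> Omega R d -> R),
    grad_decomposition F t l c.
Proof.
move=> ZF; have h1 : 0 < (1 : R) <= 1 by rewrite ltr01 lexx.
have [k [T [f [_ [q [gT sf _ _ [FE _]]]]]]] := cylZ_common_grid ZF ZF h1.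
exists ('I_k.+1 * 'I_d)%type, (fun p => set_val (T p.1) : R), snd,
  (fun p g => 'D_(delta_mx p.1 p.2) f (sample T g)); split.
- move=> [i l] /=; have [T0 _ _] := gT; rewrite T0/=.
  by case/andP: (time_bounds (T i)).
- by move=> [i l]; exact: (cylZ_sample gT (smooth_derive i l sf)).
- move=> g s s0; apply/rowP => m; rewrite FE grad_sample// summxE.
  rewrite -(pair_bigA _ (fun i l => ('D_(delta_mx i l) f (sample T g) *:
    kern (set_val (T i)) l s) ord0 m))/=.
  apply: eq_bigr => i _; rewrite (bigD1 m)//= big1 ?addr0.
    by rewrite !mxE !eqxx mulr1 mulrC.
  by move=> j jm; rewrite !mxE eq_sym (negbTE jm) !mulr0.
Qed.

Section decomposition.
Variables (F : Omega R d -> R) (I : finType) (t : I -> R) (l : I -> 'I_d).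
Variable (c : I -> Omega R d -> R).
Hypothesis Fc : grad_decomposition F t l c.

Lemma grad_ae_derivative g :
  ae_derivative (grad F g) (lincomb_dkern t l (c^~ g)).
Proof.
have [t01 Zc Fg] := Fc.
apply: (@ae_derivative_congr _ _ (fun s => \sum_i c i g *: kern (t i) (l i) s)).
  by move=> s s0; rewrite Fg.
split; first exact: L2_lincomb_dkern.
have cN : countable (range t).
  by apply: finite_set_countable; apply: finite_image; exact: finite_finset.
exists (range t); split.
- exact: countable_measurable.
- exact: countable_lebesgue_measure0.
move=> x Ix Nx; rewrite /lincomb_dkern.
elim: (index_enum I) => [|i r IH].
  by under eq_fun do rewrite big_nil; rewrite big_nil; exact: is_derive_cst.
under eq_fun do rewrite big_cons; rewrite big_cons.
have := @is_derive_kern R d (t i) (l i) x.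
case: eqVneq => [xt|_ /(_ isT) dk]; first by exfalso; apply: Nx; exists i.
by apply: is_deriveD; exact: is_deriveZ.
Qed.

(** The reproducing property. *)
Lemma ip_dkern_grad g s m : 0 <= s <= 1 ->
  ip (dkern s m) (lincomb_dkern t l (c^~ g)) = dirD F s m g.
Proof.
move=> s01; have [t01 Zc Fg] := Fc.
rewrite ipC ip_lincomb_dkern; last exact: L2_dkern.
rewrite /dirD Fg; last by case/andP: s01.
rewrite summxE; apply: eq_bigr => i _.
rewrite ip_dkern//; last by have /andP[/ltW -> ->] := t01 i.
by rewrite !mxE eqxx/= eq_sym.
Qed.

Lemma energyE g : energy F g = \sum_i c i g * dirD F (t i) (l i) g.
Proof.
have [t01 Zc Fg] := Fc.
rewrite /energy (Hdot_self (grad_ae_derivative g)).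
rewrite ip_lincomb_dkern; last exact: L2_lincomb_dkern.
apply: eq_bigr => i _; rewrite ip_dkern_grad//.
by have /andP[/ltW -> ->] := t01 i.
Qed.

Lemma Hdot_grad_sub g (u b : R -> 'rV[R]_d) : ae_derivative u b ->
  Hdot (grad F g - u) (grad F g - u) =
  energy F g - 2 * \sum_i c i g * ip (dkern (t i) (l i)) b + ip b b.
Proof.
move=> ub; have Fg := grad_ae_derivative g.
rewrite (Hdot_self (ae_derivativeB Fg ub)) /energy (Hdot_self Fg).
rewrite (ip_lincomb _ Fg.1 ub.1) (ip_lincomb_dkern _ _ _ ub.1); ring.
Qed.

End decomposition.

Lemma energy_ge0 F g : cylZ F -> 0 <= energy F g.
Proof.
move=> /grad_decomp[I [t [l [c Fc]]]].
by rewrite /energy (Hdot_self (grad_ae_derivative Fc g)) ip_ge0.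
Qed.

Lemma cylZ_energy F : cylZ F -> cylZ (energy F).
Proof.
move=> ZF; have [I [t [l [c Fc]]]] := grad_decomp ZF.
have [t01 Zc _] := Fc.
rewrite (funext (energyE Fc)).
elim: (index_enum I) => [|i r IH].
  by under eq_fun do rewrite big_nil; exact: cylZ_cst.
under eq_fun do rewrite big_cons; apply: cylZD => //; apply: cylZM => //.
by apply: cylZ_dirD => //; case/andP: (t01 i) => /ltW.
Qed.

(** The reproducing element at s <= 1 has norm at most 1. *)
Lemma dirD_sqr_le_energy F s m g : cylZ F -> 0 <= s <= 1 ->
  (dirD F s m g) ^+ 2 <= energy F g.
Proof.
move=> ZF s01; have [I [t [l [c Fc]]]] := grad_decomp ZF.
have Fg := grad_ae_derivative Fc g.
rewrite -(ip_dkern_grad Fc g m s01) /energy (Hdot_self Fg).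
have := ip_CS (@L2_dkern R d s m) Fg.1.
rewrite ip_dkern// eqxx mulr1 minxx => h.
rewrite -[leRHS]sqr_sqrtr ?ip_ge0// -[leLHS]real_normK ?num_real// lerXn2r ?nnegrE ?sqrtr_ge0//.
apply: (le_trans h); rewrite ler_piMl ?sqrtr_ge0//.
by rewrite -sqrtr1 ler_wsqrtr//; case/andP: s01.
Qed.

Lemma energy_sub F G g (a b : R -> 'rV[R]_d) : cylZ F -> cylZ G ->
  ae_derivative (grad F g) a -> ae_derivative (grad G g) b ->
  energy (F \- G) g = ip (fun x => a x + (-1) *: b x) (fun x => a x + (-1) *: b x).
Proof.
move=> ZF ZG Fa Gb; apply: Hdot_self.
apply: ae_derivative_congr (ae_derivativeB Fa Gb) => x x0.
apply/rowP => k; rewrite [LHS]mxE [X in _ + X]mxE.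
by rewrite -[RHS]/(dirD (F \- G) x k g) dirDB.
Qed.

(** A quantitative form of weak lower semicontinuity of the norm: the mixed term
    of |DF - DG|^2 only involves finitely many directional derivatives of G. *)
Lemma energy_sub_ge F (I : finType) (t : I -> R) (l : I -> 'I_d)
    (c : I -> Omega R d -> R) G g :
  grad_decomposition F t l c -> cylZ F -> cylZ G ->
  energy F g - 2 * \sum_i c i g * dirD G (t i) (l i) g <= energy (F \- G) g.
Proof.
move=> Fc ZF ZG; have [t01 Zc _] := Fc.
have [J [s [m [e Ge]]]] := grad_decomp ZG.
have Fg := grad_ae_derivative Fc g; have Gg := grad_ae_derivative Ge g.
rewrite (energy_sub ZF ZG Fg Gg) -(Hdot_self (ae_derivativeB Fg Gg)).
rewrite (Hdot_grad_sub Fc g Gg).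
under [in leRHS]eq_bigr => i _.
  rewrite (ip_dkern_grad Ge); last by have /andP[/ltW -> ->] := t01 i.
  over.
by rewrite lerDl ip_ge0.
Qed.

End gradient_energy.

(** * Closability of the energy *)

Lemma fatou_cvg_le dd (T : measurableType dd) (R : realType)
    (mu : {measure set T -> \bar R}) (h : nat -> T -> \bar R) (f : T -> \bar R)
    (e : \bar R) :
  (forall k, measurable_fun setT (h k)) -> measurable_fun setT f ->
  (forall k x, 0 <= h k x)%E -> (forall x, 0 <= f x)%E ->
  {ae mu, forall x, h k x @[k --> \oo] --> f x} ->
  (forall k, \int[mu]_x h k x <= e)%E -> (\int[mu]_x f x <= e)%E.
Proof.
move=> mh mf h0 f0 hf he.
have hei x n : (einfs (h^~ x) n <= h n x)%E by apply: ereal_inf_lbound; exists n => /=.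
apply: (@le_trans _ _ (\int[mu]_x limn_einf (h^~ x))%E).
  apply: ae_ge0_le_integral => //.
  - move=> x _; rewrite limn_einf_lim.
    apply: lime_ge; first exact: is_cvg_einfs.
    by apply: nearW => n; apply: le_ereal_inf_tmp => _ [m _ <-].
  - under eq_fun do rewrite limn_einf_lim.
    apply: (emeasurable_fun_cvg (fun n x => einfs (h^~ x) n)).
      by move=> n; exact: measurable_fun_einfs.
    by move=> x _; exact: is_cvg_einfs.
  - by apply: filterS hf => x /cvg_limn_einf_sup[-> _] _.
apply: (le_trans (fatou mu measurableT mh (fun k x _ => h0 k x))).
rewrite limn_einf_lim; apply: lime_le; first exact: is_cvg_einfs.
apply: nearW => n; apply: le_trans (he n).
by apply: ereal_inf_lbound; exists n => /=.
Qed.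

Lemma ge0_cvge0P (R : realType) (I : Type) (FF : set_system I) {PF : Filter FF}
    (y : I -> \bar R) : (forall i, 0 <= y i)%E ->
  y @ FF --> 0%E <-> (forall e : R, 0 < e -> \forall i \near FF, (y i <= e%:E)%E).
Proof.
move=> y0; split=> [/fine_cvgP[yfin yc] e e0|ye].
  move/cvgr0_norm_le : yc => /(_ e e0).
  apply: filterS2 yfin => i fi /=; rewrite ger0_norm ?fine_ge0// => yi.
  by rewrite -(fineK fi) lee_fin.
apply/fine_cvgP; split.
  apply: filterS (ye 1 ltr01) => i yi.
  by rewrite ge0_fin_numE//; apply: le_lt_trans yi _; rewrite ltry.
apply/cvgr0Pnorm_le => e e0; apply: filterS (ye e e0) => i yi /=.
rewrite ger0_norm ?fine_ge0// -lee_fin fineK//.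
by rewrite ge0_fin_numE//; apply: le_lt_trans yi _; rewrite ltry.
Qed.

Section weighted.
Context (R : realType) (d : nat).
Local Notation Om := (Omega R d).
Variables (nu : probability Om R) (wiener_nu : is_wiener nu) (w : Om -> R).
Hypothesis mw : measurable_fun setT w.
Hypothesis w0 : forall g, 0 <= w g.
Hypothesis wpos : {ae nu, forall g, 0 < w g}.
Hypothesis iw : nu.-integrable setT (EFin \o w).
Hypothesis idiv : forall K, cylZ K -> nu.-integrable setT (fun g => (K g ^+ 2 / w g)%:E).
Local Open Scope ereal_scope.

(** Pointwise x y <= x^2 w / e + e y^2 / w wherever w is positive. *)
Lemma weighted_young (a b : Om -> R) (e : R) : (0 < e)%R ->
  measurable_fun setT a -> measurable_fun setT b ->
  measurable_fun setT (fun g => (b g ^+ 2 / w g)%R) ->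
  \int[nu]_g (`|a g * b g|)%:E <=
  e^-1%:E * \int[nu]_g (a g ^+ 2 * w g)%:E + e%:E * \int[nu]_g (b g ^+ 2 / w g)%:E.
Proof.
move=> e0 ma mb mbw.
have ei0 : (0 < e^-1)%R by rewrite invr_gt0.
have maw : measurable_fun setT (fun g => (a g ^+ 2 * w g)%:E).
  by apply/measurable_EFinP; apply: measurable_funM => //; exact: measurable_funX.
have mbw' : measurable_fun setT (fun g => (b g ^+ 2 / w g)%:E).
  exact/measurable_EFinP.
have aw0 g : 0 <= (a g ^+ 2 * w g)%:E by rewrite lee_fin mulr_ge0// sqr_ge0.
have bw0 g : 0 <= (b g ^+ 2 / w g)%:E by rewrite lee_fin divr_ge0// sqr_ge0.
rewrite -ge0_integralZl_EFin//; last exact: ltW.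
rewrite -ge0_integralZl_EFin//; last exact: ltW.
rewrite -ge0_integralD//; last 4 first.
- by move=> g _; rewrite mule_ge0// lee_fin ltW.
- exact: measurable_funeM.
- by move=> g _; rewrite mule_ge0// lee_fin ltW.
- exact: measurable_funeM.
apply: ae_ge0_le_integral => //.
- by apply/measurable_EFinP/measurableT_comp => //; exact: measurable_funM.
- by move=> g _; rewrite adde_ge0// mule_ge0// lee_fin ltW.
- by apply: emeasurable_funD; exact: measurable_funeM.
apply: filterS wpos => g wg _; rewrite -!EFinM -EFinD lee_fin normrM.
rewrite -[X in (_ * (X * _) + _)%R]real_normK ?num_real//.
rewrite -[X in (_ + _ * (X / _))%R]real_normK ?num_real//.
set x := `|a g|%R; set y := `|b g|%R.
have x0 : (0 <= x)%R := normr_ge0 _.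
have y0 : (0 <= y)%R := normr_ge0 _.
rewrite -subr_ge0 (_ : (_ - _)%R =
  ((x * w g - e * y) ^+ 2 / (e * w g) + x * y)%R); last first.
  by field; rewrite !gt_eqF.
apply: addr_ge0; last exact: mulr_ge0.
by rewrite divr_ge0 ?sqr_ge0// mulr_ge0// ltW.
Qed.

(** The Young inequality for the product 1 * F. *)
Lemma cylZ_integrable F : cylZ F -> nu.-integrable setT (EFin \o F).
Proof.
move=> ZF; have mF := measurable_cylZ ZF.
apply/integrableP; split; first exact/measurable_EFinP.
have mbw : measurable_fun setT (fun g => (F g ^+ 2 / w g)%R).
  by have /measurable_int/measurable_EFinP := idiv ZF.
have := @weighted_young (cst 1%R) F 1 ltr01 (measurable_cst _) mF mbw.
under eq_integral do rewrite mul1r.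
move=> /le_lt_trans; apply; rewrite invr1 !mul1e.
apply: lte_add_pinfty.
- under eq_integral do rewrite expr1n mul1r.
  have /integrableP[_] := iw; apply: le_lt_trans.
  by rewrite le_eqVlt; apply/orP; left; apply/eqP; apply: eq_integral => g _;
    rewrite gee0_abs// lee_fin.
- have /integrableP[_] := idiv ZF; apply: le_lt_trans.
  by rewrite le_eqVlt; apply/orP; left; apply/eqP; apply: eq_integral => g _;
    rewrite gee0_abs// lee_fin divr_ge0// sqr_ge0.
Qed.

Definition div_norm (K : Om -> R) : R := (fine (\int[nu]_g (K g ^+ 2 / w g)%:E))%R.

Lemma div_normE K : cylZ K -> \int[nu]_g (K g ^+ 2 / w g)%:E = (div_norm K)%:E.
Proof.
by move=> ZK; rewrite /div_norm fineK//; exact: integrable_fin_num (idiv ZK).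
Qed.

Lemma div_norm_ge0 K : (0 <= div_norm K)%R.
Proof.
by apply: fine_ge0; apply: integral_ge0 => g _; rewrite lee_fin divr_ge0// sqr_ge0.
Qed.

(** In the Young inequality the first term tends to 0 for fixed e, and the second
    one is e times a constant. *)
Lemma pairing_cvg0 (F : nat -> Om -> R) (K : Om -> R) :
  (forall n, cylZ (F n)) -> cylZ K ->
  \int[nu]_g (F n g ^+ 2 * w g)%:E @[n --> \oo] --> 0 ->
  \int[nu]_g (F n g * K g)%:E @[n --> \oo] --> 0.
Proof.
move=> ZF ZK F0.
have mK := measurable_cylZ ZK.
have mbw : measurable_fun setT (fun g => (K g ^+ 2 / w g)%R).
  by have /measurable_int/measurable_EFinP := idiv ZK.
have cE := div_normE ZK; have c0 := div_norm_ge0 K; set c := div_norm K in cE c0.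
have aF n : 0 <= \int[nu]_g (F n g ^+ 2 * w g)%:E.
  by apply: integral_ge0 => g _; rewrite lee_fin mulr_ge0// sqr_ge0.
have bound e n : (0 < e)%R -> `|\int[nu]_g (F n g * K g)%:E| <=
    e^-1%:E * \int[nu]_g (F n g ^+ 2 * w g)%:E + (e * c)%:E.
  move=> e0; have mFn := measurable_cylZ (ZF n).
  rewrite EFinM -cE; apply: le_trans (weighted_young e0 mFn mK mbw).
  apply: le_abse_integral => //.
  by apply/measurable_EFinP; exact: measurable_funM.
apply/cvg_abse0P.
apply: (proj2 (@ge0_cvge0P R nat \oo _ (abse \o (fun n => \int[nu]_g (F n g * K g)%:E))
  (fun n => abse_ge0 _))) => e e0.
have c1 : (0 < c + 1)%R by rewrite ltr_wpDl.
(* Then e' c <= e / 2 bounds the second term, the first one being <= e / 2. *)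
pose e' := (e / (2 * (c + 1)))%R.
have e'0 : (0 < e')%R by rewrite divr_gt0// mulr_gt0.
have e2 : (0 < e' * (e / 2))%R by rewrite mulr_gt0// divr_gt0.
have := proj1 (@ge0_cvge0P R nat \oo _ _ aF) F0 _ e2 => near_e2; near=> n.
have Fn : \int[nu]_g (F n g ^+ 2 * w g)%:E <= (e' * (e / 2))%:E.
  by near: n; exact: near_e2.
apply: (le_trans (bound e' n e'0)).
apply: (@le_trans _ _ (e'^-1%:E * (e' * (e / 2))%:E + (e' * c)%:E)).
  by rewrite leeD2r// lee_wpmul2l// lee_fin invr_ge0 ltW.
rewrite -EFinM -EFinD lee_fin mulKf ?gt_eqF//.
suff : (e' * c <= e / 2)%R by lra.
rewrite /e' invfM mulrA -[X in (_ <= X)%R]mulr1 -mulrA ler_wpM2l//.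
  by rewrite divr_ge0// ltW.
by rewrite mulrC ler_pdivrMr// mul1r lerDl.
Unshelve. all: by end_near. Qed.

(** The Young inequality with e = 2^-k makes the increments of v summable in
    L^1(nu). So v converges almost everywhere with an integrable bound, and by
    dominated convergence the limit is orthogonal to the cylindrical functions
    with values in [0, 1]. *)
Lemma cvg_ae_of_fast (v : nat -> Om -> R) :
  (forall k, cylZ (v k)) ->
  (forall k, \int[nu]_g ((v k.+1 g - v k g) ^+ 2 * w g)%:E <= ((4 ^ k)%:R^-1)%:E) ->
  (forall K, cylZ K -> (forall g, (0 <= K g <= 1)%R) ->
     \int[nu]_g (v k g * K g)%:E @[k --> \oo] --> 0) ->
  {ae nu, forall g, v k g @[k --> \oo] --> (0 : R)%R}.
Proof.
move=> Zv vfast vK.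
pose dv k g := `|v k.+1 g - v k g|%R.
pose S g := \sum_(0 <= k <oo) (dv k g)%:E.
have dv0 k g : (0 <= dv k g)%R by exact: normr_ge0.
have mv k : measurable_fun setT (v k) := measurable_cylZ (Zv k).
have mdv' k : measurable_fun setT (fun g => v k.+1 g - v k g)%R.
  by apply: measurable_funB.
have mdv k : measurable_fun setT (fun g => (dv k g)%:E).
  by apply/measurable_EFinP/measurableT_comp.
have mS : measurable_fun setT S.
  apply: ge0_emeasurable_sum => [k g _ _|k _]; last exact: mdv.
  by rewrite lee_fin.
have Z1 : cylZ (fun _ : Om => 1%R) by exact: cylZ_cst.
pose c := (1 + div_norm (fun=> 1))%R.
have c0 : (0 <= c)%R by rewrite addr_ge0// div_norm_ge0.
have idv k : \int[nu]_g (dv k g)%:E <= ((c * 2) / (2 ^ k.+1)%:R)%:E.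
  have k0 : (0 < (2 ^ k)%:R :> R)%R by rewrite ltr0n expn_gt0.
  have ki0 : (0 < (2 ^ k)%:R^-1 :> R)%R by rewrite invr_gt0.
  have mbw : measurable_fun setT (fun g => (1 ^+ 2 / w g)%R).
    by have /measurable_int/measurable_EFinP := idiv Z1.
  have := weighted_young ki0 (mdv' k) (measurable_cst (1%R : R)) mbw.
  under eq_integral do rewrite mulr1.
  move=> /le_trans; apply; rewrite (div_normE Z1).
  apply: (@le_trans _ _ ((2 ^ k)%:R%:E * ((4 ^ k)%:R^-1)%:E +
     ((2 ^ k)%:R^-1)%:E * (div_norm (fun=> 1))%:E)).
    rewrite invrK; apply: leeD2r; apply: lee_wpmul2l; first by rewrite lee_fin.
    exact: vfast.
  rewrite -!EFinM -EFinD lee_fin (_ : 4 = 2 * 2)%N// expnMn expnS !natrM.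
  rewrite /c le_eqVlt; apply/orP; left; apply/eqP.
  by field; rewrite gt_eqF.
have iS : nu.-integrable setT S.
  apply/integrableP; split => //.
  under eq_integral => g _.
    rewrite gee0_abs; last by apply: nneseries_ge0 => k _ _; rewrite lee_fin.
    over.
  rewrite integral_nneseries//; last by move=> k g _; rewrite lee_fin.
  apply: (@le_lt_trans _ _ (c * 2)%:E); last by rewrite ltry.
  apply: le_trans (@epsilon_trick0 R (c * 2)%R xpredT _); last first.
    by rewrite mulr_ge0.
  apply: lee_nneseries => [k _ _|k _]; last exact: idv.
  by apply: integral_ge0 => g _; rewrite lee_fin.
pose A := [set g | S g < +oo].
have mA : measurable A by rewrite -[A]setTI; exact: emeasurable_fun_infty_o.
have aeA : {ae nu, forall g, A g}.
  have := integrable_ae measurableT iS; apply: filterS => g /(_ I).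
  by rewrite fin_numE => /andP[_]; rewrite -ltey.
have v_tel k g : v k g = (v 0 g + series (fun i => v i.+1 g - v i g) k)%R.
  by rewrite /series/= telescope_sumr// addrC subrK.
have cv g : A g -> cvgn (v^~ g).
  move=> Ag; have : cvgn (series (fun i => v i.+1 g - v i g)%R).
    apply: normed_cvg; apply: (@nnseries_is_cvg R (dv^~ g)) => [i|]; first exact: dv0.
    exact: Ag.
  move=> cs; rewrite (_ : v^~ g = fun k => (v 0 g + series (fun i => v i.+1 g - v i g) k)%R).
    by apply: is_cvgD => //; exact: is_cvg_cst.
  by apply/funext => k; exact: v_tel.
pose X g := limn (fun k => v k g * \1_A g)%R.
have cX g : (v k g * \1_A g)%R @[k --> \oo] --> X g.
  suff : cvgn (fun k => v k g * \1_A g)%R by [].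
  rewrite indicE; have [/set_mem Ag|Ag] := boolP (g \in A).
    by under eq_fun do rewrite mulr1; exact: cv.
  by under eq_fun do rewrite mulr0; exact: is_cvg_cst.
have mX : measurable_fun setT X.
  apply: (@measurable_fun_cvg _ _ _ _ (fun k g => v k g * \1_A g)%R).
    by move=> k; apply: measurable_funM => //; exact: measurable_indic.
  by move=> g _; exact: cX.
have vX g : A g -> v k g @[k --> \oo] --> X g.
  move=> Ag; have := cX g; rewrite indicE mem_set//.
  by under eq_fun do rewrite mulr1.
pose D g := `|v 0 g|%:E + S g.
have iD : nu.-integrable setT D.
  by apply: integrableD => //; exact: (integrable_abse (cylZ_integrable (Zv 0%N))).
have vD k g : `|v k g|%:E <= D g.
  rewrite /D v_tel; apply: (@le_trans _ _ (`|v 0 g| + \sum_(0 <= i < k) dv i g)%:E).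
    rewrite lee_fin (le_trans (ler_normD _ _))// lerD2l.
    exact: ler_norm_sum.
  rewrite EFinD leeD2l// -sumEFin; apply: nneseries_lim_ge => i _ _.
  by rewrite lee_fin.
have DCT K : cylZ K -> (forall g, (0 <= K g <= 1)%R) ->
    nu.-integrable setT (fun g => (X g * K g)%:E) /\
    \int[nu]_g (X g * K g)%:E = 0.
  move=> ZK K01; have mK := measurable_cylZ ZK.
  have mf k : measurable_fun setT (fun g => (v k g * K g)%:E).
    by apply/measurable_EFinP; exact: measurable_funM.
  have mXK : measurable_fun setT (fun g => (X g * K g)%:E).
    by apply/measurable_EFinP; exact: measurable_funM.
  have [] := @dominated_convergence _ _ _ nu setT measurableT
    (fun k g => (v k g * K g)%:E) (fun g => (X g * K g)%:E) D mf mXK.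
  - apply: filterS aeA => g Ag _; apply: cvg_EFin; first by near=> k.
    by apply: cvgMl; exact: vX.
  - exact: iD.
  - apply: aeW => g k _; have /andP[K0 K1] := K01 g.
    apply: le_trans (vD k g); rewrite lee_fin normrM (ger0_norm K0).
    by rewrite ler_piMr.
  move=> iXK _ c1; split=> //; have := vK K ZK K01.
  by move=> /(cvg_unique (@ereal_hausdorff R) c1).
have iX : nu.-integrable setT (EFin \o X).
  have K01 (g : Om) : (0 <= (1 : R) <= 1)%R by rewrite ler01 lexx.
  have [+ _] := DCT _ Z1 K01.
  by under eq_fun do rewrite mulr1.
have X0 := cylZ_total iX (fun K ZK K01 => (DCT K ZK K01).2).
apply: filterS2 aeA X0 => g Ag /(_ I) [Xg].
by rewrite -Xg; exact: vX.
Unshelve. all: by end_near. Qed.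

(** Integration by parts turns the pairings of dirD (F k) s l with a cylindrical
    function into pairings of F k, and these tend to 0. *)
Lemma dirD_fast_cvg0 (F : nat -> Om -> R) (s : R) (l : 'I_d) :
  (forall k, cylZ (F k)) ->
  \int[nu]_g (F k g ^+ 2 * w g)%:E @[k --> \oo] --> 0 ->
  (forall k, \int[nu]_g (energy (F k.+1 \- F k)%R g * w g)%:E <= ((4 ^ k)%:R^-1)%:E) ->
  (0 < s <= 1)%R ->
  {ae nu, forall g, dirD (F k) s l g @[k --> \oo] --> (0 : R)%R}.
Proof.
move=> ZF F0 Ffast /andP[s0 s1].
have sge0 := ltW s0.
have s01 : (0 <= s <= 1)%R by rewrite sge0.
have Zv k : cylZ (dirD (F k) s l) by exact: cylZ_dirD.
apply: cvg_ae_of_fast => [//|k|K ZK _].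
- apply: le_trans (Ffast k).
  have ZE : cylZ (energy (F k.+1 \- F k)%R) by apply: cylZ_energy; exact: cylZB.
  apply: ge0_le_integral => //.
  + by move=> g _; rewrite lee_fin mulr_ge0// sqr_ge0.
  + apply/measurable_EFinP; apply: measurable_funM => //; apply: measurable_funX.
    by apply: measurable_funB; exact: measurable_cylZ.
  + apply/measurable_EFinP; apply: measurable_funM => //.
    exact: measurable_cylZ ZE.
  + move=> g _; rewrite lee_fin ler_wpM2r// -dirDB//.
    by apply: dirD_sqr_le_energy => //; exact: cylZB.
- pose t := to_time s; have ts : set_val t = s :> R by exact: to_timeK.
  have ZK' : cylZ (fun g => K g * path_at g t ord0 l - dirD K s l g)%R.
    apply: cylZB; last exact: cylZ_dirD.
    by apply: cylZM => //; exact: cylZ_coord.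
  have E k : \int[nu]_g (dirD (F k) s l g * K g)%:E =
      \int[nu]_g (F k g * (K g * path_at g t ord0 l - dirD K s l g))%:E.
    have := wiener_ibp2 wiener_nu cylZ_integrable (s := t) l (ZF k) ZK.
    by rewrite ts; apply.
  by under eq_fun do rewrite E; exact: pairing_cvg0.
Qed.

Lemma cauchy_subsequence (E : nat -> nat -> \bar R) :
  (forall e : R, (0 < e)%R -> exists N, forall p q, (N <= p)%N -> (N <= q)%N ->
     E p q <= e%:E) ->
  exists n_ : nat -> nat, (forall k, (k <= n_ k)%N) /\
    forall k, E (n_ k.+1) (n_ k) <= ((4 ^ k)%:R^-1)%:E.
Proof.
move=> cE.
have H (k : nat) : exists N, forall p q, (N <= p)%N -> (N <= q)%N ->
    E p q <= ((4 ^ k)%:R^-1)%:E.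
  by apply: cE; rewrite invr_gt0 ltr0n expn_gt0.
have [N_ HN] := choice H.
pose n_ k := (\sum_(i < k.+1) (N_ i).+1)%N.
have nS k : n_ k.+1 = (n_ k + (N_ k.+1).+1)%N by rewrite /n_ big_ord_recr.
have Nn k : (N_ k <= n_ k)%N.
  by rewrite /n_ big_ord_recr/=; apply: leq_trans (leq_addl _ _); rewrite leqnSn.
exists n_; split=> [|k].
  elim=> [//|k IH]; rewrite nS addnS ltnS.
  exact: leq_trans IH (leq_addr _ _).
by apply: HN => //; rewrite nS; exact: leq_trans (Nn k) (leq_addr _ _).
Qed.

(** For fixed p, the energies of F p - F (n_ k) are small in mean for large p and
    k, and almost everywhere their limit inferior over k is at least the energy
    of F p. *)
Lemma energy_closable (F : nat -> Om -> R) :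
  (forall n, cylZ (F n)) ->
  \int[nu]_g (F n g ^+ 2 * w g)%:E @[n --> \oo] --> 0 ->
  (forall e : R, (0 < e)%R -> exists N, forall p q, (N <= p)%N -> (N <= q)%N ->
     \int[nu]_g (energy (F p \- F q)%R g * w g)%:E <= e%:E) ->
  forall e : R, (0 < e)%R -> exists N, forall p, (N <= p)%N ->
     \int[nu]_g (energy (F p) g * w g)%:E <= e%:E.
Proof.
move=> ZF F0 cE e e0; have [N HN] := cE e e0.
have [n_ [kn nfast]] := cauchy_subsequence cE.
have n_oo : n_ @ \oo --> \oo.
  by apply/cvgnyPge => A; near=> k; apply: leq_trans (kn k); near: k; exact: nbhs_infty_ge.
have F0' : \int[nu]_g (F (n_ k) g ^+ 2 * w g)%:E @[k --> \oo] --> 0.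
  exact: (cvg_comp n_ _ n_oo F0).
exists N => p Np; have [I [t [l [c Fc]]]] := grad_decomp (ZF p).
have [t01 Zc _] := Fc.
have ZE G : cylZ G -> measurable_fun setT (fun g => energy G g * w g)%R.
  by move=> ZG; apply: measurable_funM => //; exact: (measurable_cylZ (cylZ_energy ZG)).
have aeD : {ae nu, forall g, forall i, dirD (F (n_ k)) (t i) (l i) g @[k --> \oo] --> (0 : R)%R}.
  apply: filter_forall => i; apply: dirD_fast_cvg0 => //.
(* The minimum with the energy of F p turns the lower bound on the limit
   inferior of u into convergence, as the minimum is bounded above as well. *)
pose u k g := energy (F p \- F (n_ (k + N)%N))%R g.
pose h k g := (Num.min (u k g) (energy (F p) g) * w g)%:E.
have eg0 g : (0 <= energy (F p) g)%R by exact: energy_ge0.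
have u0 k g : (0 <= u k g)%R by apply: energy_ge0; exact: cylZB.
have mu_ k : measurable_fun setT (u k).
  by apply: measurable_cylZ; apply: cylZ_energy; exact: cylZB.
have me : measurable_fun setT (energy (F p)).
  by apply: measurable_cylZ; exact: cylZ_energy.
have mh k : measurable_fun setT (h k).
  apply/measurable_EFinP; apply: measurable_funM => //.
  exact: (measurable_minr (mu_ k) me).
have h0 k g : 0 <= h k g.
  rewrite /h lee_fin; apply: mulr_ge0; last exact: w0.
  by rewrite le_min; apply/andP; split; [exact: u0|exact: eg0].
apply: (fatou_cvg_le (h := h)) => //.
- by apply/measurable_EFinP; exact: (ZE _ (ZF p)).
- by move=> g; rewrite lee_fin mulr_ge0.
- apply: filterS aeD => g Dg.
  apply: cvg_EFin; first by near=> k.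
  apply: cvgMl.
  pose C k := (\sum_i c i g * dirD (F (n_ (k + N)%N)) (t i) (l i) g)%R.
  have C0 : C k @[k --> \oo] --> (0 : R)%R.
    rewrite /C; elim: (index_enum I) => [|i r IH].
      by under eq_fun do rewrite big_nil; exact: cvg_cst.
    under eq_fun do rewrite big_cons.
    have Di : dirD (F (n_ (k + N)%N)) (t i) (l i) g @[k --> \oo] --> (0 : R)%R.
      by rewrite (@cvg_shiftn N _ (fun k => dirD (F (n_ k)) (t i) (l i) g)); exact: Dg.
    have := cvgD (cvgM (cvg_cst (c i g)) Di) IH.
    by rewrite mulr0 addr0 => H; exact: H.
  have Cb : \forall k \near \oo, (energy (F p) g - 2 * `|C k| <=
      Num.min (u k g) (energy (F p) g) <= energy (F p) g)%R.
    apply: nearW => k.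
    have := energy_sub_ge g Fc (ZF p) (ZF (n_ (k + N)%N)); rewrite -/(C k) -/(u k g).
    move: (u k g) (C k) (energy (F p) g) => a b B h1.
    rewrite le_min ge_min lexx orbT andbT; apply/andP; split.
      by have := ler_norm b; lra.
    by have := normr_ge0 b; lra.
  have C1 : `|C k|%R @[k --> \oo] --> (0 : R)%R.
    by have := cvg_norm C0; rewrite normr0 => H; exact: H.
  have lower : (energy (F p) g - 2 * `|C k|)%R @[k --> \oo] --> energy (F p) g.
    have := cvgB (cvg_cst (energy (F p) g)) (cvgM (cvg_cst (2 : R)%R) C1).
    by rewrite mulr0 subr0 => H; exact: H.
  exact: (squeeze_cvgr Cb lower (cvg_cst _)).
- move=> k; apply: le_trans (HN p (n_ (k + N)%N) Np _); last first.
    by apply: leq_trans (kn _); rewrite leq_addl.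
  apply: ge0_le_integral => //.
  + by apply/measurable_EFinP; exact: (ZE _ (cylZB (ZF p) (ZF _))).
  + move=> g _; rewrite /h lee_fin /u; apply: ler_wpM2r; first exact: w0.
    by move: (energy _ g) (energy _ g) => a b; rewrite ge_min lexx.
Unshelve. all: by end_near. Qed.

End weighted.

(** * Closability of the gradient *)

Section Hopen_measurable.
Context (R : realType) (d : nat).
Implicit Types f g : R -> 'rV[R]_d.

Lemma Hdot_ge0 f : 0 <= Hdot f f.
Proof. exact: ip_ge0. Qed.

Lemma Hnorm_sqr f : Hnorm f ^+ 2 = Hdot f f.
Proof. by rewrite /Hnorm sqr_sqrtr// Hdot_ge0. Qed.

(** By Cauchy-Schwarz f |-> ip a f' is Lipschitz for the norm of H. *)
Lemma Hopen_functional a c : L2_01 a ->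
  Hopen [set f | c < ip a (derive1 f : R -> 'rV[R]_d)].
Proof.
move=> La f Cf cf.
pose M := Num.sqrt (ip a a) + 1.
have M0 : 0 < M by rewrite ltr_wpDl// sqrtr_ge0.
have e0 : 0 < ip a (derive1 f) - c by rewrite subr_gt0; exact: cf.
exists ((ip a (derive1 f) - c) / M); first exact: divr_gt0.
move=> g Cg; rewrite (ltr_pdivlMr _ _ M0) => gf.
have Df := cameron_martin_derivative Cf.
have Dg := cameron_martin_derivative Cg.
have Dgf := ae_derivativeB Dg Df.
have E : ip a (derive1 g) = ip a (derive1 f) +
    ip a (fun x => derive1 g x + (-1) *: derive1 f x).
  have D := ipDl Dg.1 (L2Z (-1) Df.1) La; rewrite (ipZl (-1) Df.1 La) in D.
  have Eg := ipC a (derive1 g); have Ef := ipC a (derive1 f).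
  rewrite (ipC a (fun x => derive1 g x + (-1) *: derive1 f x)) D Eg Ef.
  by move: (ip (derive1 g) a) (ip (derive1 f) a) => y z; ring.
have := ip_CS La Dgf.1; rewrite ler_norml => /andP[+ _].
rewrite -(Hdot_self Dgf) -/(Hnorm (g - f)) => h.
have hM : Num.sqrt (ip a a) * Hnorm (g - f) <= Hnorm (g - f) * M.
  by rewrite mulrC ler_wpM2l ?sqrtr_ge0// /M lerDl.
change (c < ip a (derive1 g)); rewrite E.
have arith (y z t u : R) : - t <= z -> t <= u -> u < y - c -> c < y + z.
  by clear; lra.
exact: arith h hM gf.
Qed.

(** The triangle inequality for Hnorm, obtained from Cauchy-Schwarz. *)
Lemma Hopen_Hnorm c : Hopen [set f : R -> 'rV[R]_d | c < Hnorm f].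
Proof.
move=> f Cf cf; exists (Hnorm f - c); first by rewrite subr_gt0; exact: cf.
move=> g Cg gf; change (c < Hnorm g).
have Df := cameron_martin_derivative Cf.
have Dg := cameron_martin_derivative Cg.
have Dgf := ae_derivativeB Dg Df.
suff tri : Hnorm f <= Hnorm g + Hnorm (g - f).
  have arith (x y z : R) : x <= y + z -> z < x - c -> c < y by clear; lra.
  exact: arith tri gf.
have sf : Hnorm f ^+ 2 = _ := etrans (Hnorm_sqr f) (Hdot_self Df).
have sg : Hnorm g ^+ 2 = _ := etrans (Hnorm_sqr g) (Hdot_self Dg).
have sgf : Hnorm (g - f) ^+ 2 = _ := etrans (Hnorm_sqr (g - f)) (Hdot_self Dgf).
have lin := ip_lincomb (-1) Dg.1 Dgf.1.
have fE : (fun x => derive1 g x + -1 *: (derive1 g x + -1 *: derive1 f x)) = derive1 f.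
  by apply/funext => x; rewrite !scaleN1r opprB addrC subrK.
rewrite fE in lin.
have cs := ip_CS Dg.1 Dgf.1; rewrite ler_norml in cs; have /andP[cs1 _] := cs.
rewrite -(congr1 Num.sqrt (Hdot_self Dg)) -(congr1 Num.sqrt (Hdot_self Dgf)) in cs1.
have arith (x y z p q r s : R) : 0 <= y -> 0 <= z -> x ^+ 2 = p -> y ^+ 2 = q ->
    z ^+ 2 = r -> p = q + 2 * -1 * s + (-1) ^+ 2 * r -> - (y * z) <= s -> x <= y + z.
  clear; move=> y0 z0 <- <- <- E yz; rewrite leNgt; apply/negP => xyz; nra.
exact: (arith _ _ _ _ _ _ _ (sqrtr_ge0 _) (sqrtr_ge0 _) sf sg sgf lin cs1).
Qed.

Lemma Hopen_measurable_fun dd (T : measurableType dd) (u : T -> R -> 'rV[R]_d)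
    (psi : (R -> 'rV[R]_d) -> R) :
  (forall U, Hopen U -> measurable (u @^-1` U)) ->
  (forall c, Hopen [set f | c < psi f]) ->
  measurable_fun setT (psi \o u).
Proof.
move=> mu hpsi; apply: (measurability _ (RGenOInfty.measurableE R)).
move=> _ [_ [c ->] <-]; rewrite setTI.
have := mu _ (hpsi c); congr measurable; apply/seteqP.
by split=> x /=; rewrite in_itv/= andbT.
Qed.

End Hopen_measurable.

Section Lnorm2.
Context dd (T : measurableType dd) (R : realType) (mu : {measure set T -> \bar R}).
Implicit Types f : T -> R.
Local Open Scope ereal_scope.

Lemma Lnorm2E f : 'N[mu]_2%:E[EFin \o f] = (\int[mu]_x (f x ^+ 2)%:E) `^ 2^-1.
Proof.
rewrite unlock; congr (_ `^ _); apply: eq_integral => x _ /=.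
by rewrite powR_mulrn// real_normK ?num_real.
Qed.

Let q_ge0 f : 0 <= \int[mu]_x (f x ^+ 2)%:E.
Proof. by apply: integral_ge0 => x _; rewrite lee_fin sqr_ge0. Qed.

Lemma Lnorm2_cvg0 (f : nat -> T -> R) :
  'N[mu]_2%:E[EFin \o f n] @[n --> \oo] --> 0 ->
  \int[mu]_x (f n x ^+ 2)%:E @[n --> \oo] --> 0.
Proof.
move=> /(proj1 (@ge0_cvge0P R nat \oo _ _ (fun n => Lnorm_ge0 mu 2%:E (EFin \o f n)))) h.
apply: (proj2 (@ge0_cvge0P R nat \oo _ _ (fun n => q_ge0 (f n)))) => e e0.
have se0 : (0 < Num.sqrt e)%R by rewrite sqrtr_gt0.
have {}h := h _ se0; near=> n.
have : 'N[mu]_2%:E[EFin \o f n] <= (Num.sqrt e)%:E by near: n; exact: h.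
rewrite Lnorm2E; have := q_ge0 (f n).
case: (\int[mu]_x (f n x ^+ 2)%:E) => [r| |]//; last first.
  by rewrite poweRyr ?invr_eq0// => _; rewrite leye_eq.
rewrite lee_fin => r0; rewrite poweR_EFin lee_fin powR12_sqrt//.
by rewrite lee_fin ler_sqrt// ltW.
Unshelve. all: by end_near. Qed.

Lemma Lnorm2_eq0 f : \int[mu]_x (f x ^+ 2)%:E = 0 -> 'N[mu]_2%:E[EFin \o f] = 0.
Proof. by rewrite Lnorm2E => ->; rewrite poweR_EFin powR0// invr_eq0. Qed.

End Lnorm2.

Section operator.
Context (R : realType) (d : nat).
Local Notation Om := (Omega R d).

Lemma ip_sub_le (x y : R -> 'rV[R]_d) : L2_01 x -> L2_01 y ->
  ip (fun s => x s + (-1) *: y s) (fun s => x s + (-1) *: y s) <=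
  2 * ip x x + 2 * ip y y.
Proof.
move=> Lx Ly.
have h := ip_ge0 (fun s => x s + 1 *: y s).
have e1 := ip_lincomb 1 Lx Ly; have e2 := ip_lincomb (-1) Lx Ly.
have arith (p q r s t : R) : 0 <= s -> s = p + 2 * 1 * q + 1 ^+ 2 * r ->
    t = p + 2 * -1 * q + (-1) ^+ 2 * r -> t <= 2 * p + 2 * r by clear; lra.
exact: arith h e1 e2.
Qed.

Variables (nu : probability Om R) (w : Om -> R).
Hypothesis mw : measurable_fun setT w.
Hypothesis w0 : forall g, 0 <= w g.
Variable u : Om -> R -> 'rV[R]_d.
Hypothesis CMu : forall g, cameron_martin (u g).
Hypothesis mu : forall U, Hopen U -> measurable (u @^-1` U).

Definition distance_sqr (F : Om -> R) g : R := Hdot (grad F g - u g) (grad F g - u g).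

Lemma measurable_Hdot_self : measurable_fun setT (fun g => Hdot (u g) (u g)).
Proof.
under eq_fun do rewrite -Hnorm_sqr.
apply: measurable_funX.
exact: (Hopen_measurable_fun (psi := @Hnorm R d) mu (@Hopen_Hnorm R d)).
Qed.

Lemma measurable_ip_dkern s m :
  measurable_fun setT (fun g => ip (dkern s m) (derive1 (u g))).
Proof.
apply: (@Hopen_measurable_fun R d _ Om u (fun f => ip (dkern s m) (derive1 f)) mu).
by move=> a; apply: Hopen_functional; exact: L2_dkern.
Qed.

(** The square is expanded into the energy of F, finitely many coordinates of u,
    and the squared norm of u. *)
Lemma measurable_distance_sqr F : cylZ F -> measurable_fun setT (distance_sqr F).
Proof.
move=> ZF; have [I [t [l [c Fc]]]] := grad_decomp ZF.
have [_ Zc _] := Fc.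
have E g : distance_sqr F g = energy F g -
    2 * (\sum_i c i g * ip (dkern (t i) (l i)) (derive1 (u g))) + Hdot (u g) (u g).
  exact: (Hdot_grad_sub Fc g (cameron_martin_derivative (CMu g))).
rewrite (funext E); apply: measurable_funD; last exact: measurable_Hdot_self.
apply: measurable_funB; first exact: (measurable_cylZ (cylZ_energy ZF)).
apply: measurable_funM; first exact: measurable_cst.
apply: measurable_sum => i; apply: measurable_funM; first exact: measurable_cylZ.
exact: measurable_ip_dkern.
Qed.

Lemma distance_sqr_ge0 F g : 0 <= distance_sqr F g.
Proof. exact: Hdot_ge0. Qed.

Lemma energy_sub_le_distance F G g : cylZ F -> cylZ G ->
  energy (F \- G) g <= 2 * distance_sqr F g + 2 * distance_sqr G g.
Proof.
move=> ZF ZG.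
have [I [t [l [c Fc]]]] := grad_decomp ZF; have [J [s [m [e Ge]]]] := grad_decomp ZG.
have Fg := grad_ae_derivative Fc g; have Gg := grad_ae_derivative Ge g.
have ub := cameron_martin_derivative (CMu g).
have Fu := ae_derivativeB Fg ub; have Gu := ae_derivativeB Gg ub.
rewrite /distance_sqr (Hdot_self Fu) (Hdot_self Gu) (energy_sub ZF ZG Fg Gg).
have H := ip_sub_le Fu.1 Gu.1.
pose a := lincomb_dkern t l (c^~ g); pose a' := lincomb_dkern s m (e^~ g).
have aE : (fun x => (a x + (-1) *: derive1 (u g) x) +
    (-1) *: (a' x + (-1) *: derive1 (u g) x)) = (fun x => a x + (-1) *: a' x).
  by apply/funext => x; rewrite !scaleN1r opprB addrA subrK.
by rewrite aE in H; exact: H.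
Qed.

Lemma Hdot_le_distance F g : cylZ F ->
  Hdot (u g) (u g) <= 2 * energy F g + 2 * distance_sqr F g.
Proof.
move=> ZF; have [I [t [l [c Fc]]]] := grad_decomp ZF.
have Fg := grad_ae_derivative Fc g.
have ub := cameron_martin_derivative (CMu g).
have Fu := ae_derivativeB Fg ub.
rewrite /distance_sqr /energy (Hdot_self Fu) (Hdot_self Fg) (Hdot_self ub).
have H := ip_sub_le Fg.1 Fu.1.
pose a := lincomb_dkern t l (c^~ g).
have aE : (fun x => a x + (-1) *: (a x + (-1) *: derive1 (u g) x)) = derive1 (u g).
  by apply/funext => x; rewrite !scaleN1r opprB addrC subrK.
by rewrite aE in H; exact: H.
Qed.

Local Open Scope ereal_scope.

Lemma weighted_le2 (f f1 f2 : Om -> R) :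
  measurable_fun setT f -> measurable_fun setT f1 -> measurable_fun setT f2 ->
  (forall g, 0 <= f g)%R -> (forall g, 0 <= f1 g)%R -> (forall g, 0 <= f2 g)%R ->
  (forall g, f g <= 2 * f1 g + 2 * f2 g)%R ->
  \int[nu]_g (f g * w g)%:E <=
  2%:E * \int[nu]_g (f1 g * w g)%:E + 2%:E * \int[nu]_g (f2 g * w g)%:E.
Proof.
move=> mf mf1 mf2 f0 f10 f20 ff.
have m (h : Om -> R) : measurable_fun setT h -> measurable_fun setT (fun g => (h g * w g)%:E).
  by move=> mh; apply/measurable_EFinP; exact: measurable_funM.
have p (h : Om -> R) : (forall g, 0 <= h g)%R -> forall g, 0 <= (h g * w g)%:E.
  by move=> h0 g; rewrite lee_fin; apply: mulr_ge0.
rewrite -ge0_integralZl_EFin//; [|by move=> g _; exact: p|exact: m].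
rewrite -ge0_integralZl_EFin//; [|by move=> g _; exact: p|exact: m].
rewrite -ge0_integralD//; last 4 first.
- by move=> g _; apply: mule_ge0 => //; exact: p.
- by apply: measurable_funeM; exact: m.
- by move=> g _; apply: mule_ge0 => //; exact: p.
- by apply: measurable_funeM; exact: m.
apply: ge0_le_integral => //.
- by move=> g _; exact: p.
- exact: m.
- by apply: emeasurable_funD; apply: measurable_funeM; exact: m.
move=> g _; rewrite -!EFinM -EFinD lee_fin !mulrA -mulrDl.
by apply: ler_wpM2r.
Qed.

Hypothesis wiener_nu : is_wiener nu.
Hypothesis wpos : {ae nu, forall g, (0 < w g)%R}.
Hypothesis iw : nu.-integrable setT (EFin \o w).
Hypothesis idiv : forall K, cylZ K -> nu.-integrable setT (fun g => (K g ^+ 2 / w g)%:E).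

(** The gradients form a Cauchy sequence, so their energies tend to 0, and u,
    being close to them, has norm 0. *)
Lemma gradient_closable (F : nat -> Om -> R) :
  (forall n, cylZ (F n)) ->
  \int[nu]_g (F n g ^+ 2 * w g)%:E @[n --> \oo] --> 0 ->
  \int[nu]_g (distance_sqr (F n) g * w g)%:E @[n --> \oo] --> 0 ->
  \int[nu]_g (Hdot (u g) (u g) * w g)%:E = 0.
Proof.
move=> ZF F0 D0.
have Dge0 n : 0 <= \int[nu]_g (distance_sqr (F n) g * w g)%:E.
  apply: integral_ge0 => g _; rewrite lee_fin; apply: mulr_ge0 => //.
  exact: distance_sqr_ge0.
have Dsmall (e : R) : (0 < e)%R -> exists N, forall n, (N <= n)%N ->
    \int[nu]_g (distance_sqr (F n) g * w g)%:E <= e%:E.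
  move=> e0; have [N _ HN] := proj1 (@ge0_cvge0P R nat \oo _ _ Dge0) D0 e e0.
  by exists N => n Nn; exact: HN.
have mE G : cylZ G -> measurable_fun setT (energy G).
  by move=> ZG; exact: (measurable_cylZ (cylZ_energy ZG)).
have Esmall : forall e : R, (0 < e)%R -> exists N, forall p, (N <= p)%N ->
    \int[nu]_g (energy (F p) g * w g)%:E <= e%:E.
  apply: (energy_closable wiener_nu mw w0 wpos iw idiv ZF F0) => e e0.
  have [|N HN] := Dsmall (e / 4)%R; first by rewrite divr_gt0.
  exists N => p q Np Nq; have ZFpq := cylZB (ZF p) (ZF q).
  apply: le_trans.
    apply: (@weighted_le2 _ (distance_sqr (F p)) (distance_sqr (F q))).
    - exact: mE.
    - exact: measurable_distance_sqr.
    - exact: measurable_distance_sqr.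
    - by move=> g; exact: energy_ge0.
    - exact: distance_sqr_ge0.
    - exact: distance_sqr_ge0.
    - by move=> g; exact: energy_sub_le_distance.
  apply: (@le_trans _ _ (2%:E * (e / 4)%:E + 2%:E * (e / 4)%:E)).
    by apply: leeD; apply: lee_wpmul2l; rewrite ?lee_fin//; exact: HN.
  by rewrite -EFinM -EFinD lee_fin; lra.
apply/eqP; rewrite eq_le; apply/andP; split; last first.
  apply: integral_ge0 => g _; rewrite lee_fin; apply: mulr_ge0 => //.
  exact: Hdot_ge0.
apply/lee_addgt0Pr => e e0; rewrite add0e.
have [|N HN] := Dsmall (e / 4)%R; first by rewrite divr_gt0.
have [|M HM] := Esmall (e / 4)%R; first by rewrite divr_gt0.
pose n := maxn N M.
apply: le_trans.
  apply: (@weighted_le2 _ (energy (F n)) (distance_sqr (F n))).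
  - exact: measurable_Hdot_self.
  - exact: mE.
  - exact: measurable_distance_sqr.
  - by move=> g; exact: Hdot_ge0.
  - by move=> g; exact: energy_ge0.
  - exact: distance_sqr_ge0.
  - by move=> g; exact: Hdot_le_distance.
apply: (@le_trans _ _ (2%:E * (e / 4)%:E + 2%:E * (e / 4)%:E)).
  apply: leeD; apply: lee_wpmul2l; rewrite ?lee_fin//.
    by apply: HM; exact: leq_maxr.
  by apply: HN; exact: leq_maxl.
by rewrite -EFinM -EFinD lee_fin; lra.
Qed.

End operator.

Theorem proposition3p6 (R : realType) (d : nat)
    (nu : probability (Omega R d) R) (wiener_nu : is_wiener nu)
    (phi : Omega R d -> \bar R)
    (mphi : measurable_fun setT phi) (phi0 : forall g, (0 <= phi g)%E)
    (phi_L1 : nu.-integrable setT phi)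
    (div_L1 : forall F, cylZ F ->
       nu.-integrable setT (fun g => (F g)%:E / phi g)%E) :
  closable_form (mdensity nu mphi phi0) (@cylZ R d)
    (dform (mdensity nu mphi phi0)) /\
  closable_operator (mdensity nu mphi phi0) (@cylZ R d) (@grad R d).
Proof.
(* A finite version of phi, equal to it almost everywhere. *)
pose w g := fine (phi g).
have w0 g : 0 <= w g by exact: fine_ge0.
have mfine : measurable_fun setT (@fine R) by exact: fine_measurable.
have mw : measurable_fun setT w by exact: (measurableT_comp mfine mphi).
have Z1 : cylZ (fun _ : Omega R d => 1 : R) by exact: cylZ_cst.
have ae_phi_fin : {ae nu, forall g, phi g \is a fin_num}.
  have := integrable_ae measurableT phi_L1; apply: filterS => g; exact.
(* In the extended reals the inverse of 0 is +oo. *)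
have wpos : {ae nu, forall g, 0 < w g}.
  have := integrable_ae measurableT (div_L1 _ Z1).
  apply: filterS2 ae_phi_fin => g phifin /(_ I).
  rewrite lt_def w0 andbT mul1e; apply: contraTneq => w0g.
  have -> : phi g = 0%E by rewrite -(fineK phifin) -/(w g) w0g.
  by rewrite inve0.
have w_le g : ((w g)%:E <= phi g)%E.
  by rewrite /w; have := phi0 g; case: (phi g) => [r| |] //=; rewrite lee_fin.
have mEw : measurable_fun setT (EFin \o w) by exact/measurable_EFinP.
have iw : nu.-integrable setT (EFin \o w).
  apply: (le_integrable measurableT mEw _ phi_L1) => g _ /=.
  by rewrite ger0_norm// (le_trans (w_le g))// gee0_abs.
have idiv K : cylZ K -> nu.-integrable setT (fun g => (K g ^+ 2 / w g)%:E).
  move=> ZK; have mK := measurable_cylZ ZK.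
  have ZK2 : cylZ (fun g => K g ^+ 2) by exact: (cylZM ZK ZK).
  apply: (le_integrable measurableT _ _ (div_L1 _ ZK2)) => [|g _].
    apply/measurable_EFinP; apply: measurable_funM; first exact: measurable_funX.
    rewrite (_ : (fun g => _) = fun g => powR (w g) (-1)).
      exact: (measurableT_comp (@measurable_powR R (-1)) mw).
    by apply/funext => g; rewrite powR_inv1.
  rewrite gee0_abs ?lee_fin ?divr_ge0 ?sqr_ge0//.
  rewrite gee0_abs; last by rewrite mule_ge0 ?lee_fin ?sqr_ge0// inve_ge0.
  rewrite /w; have := phi0 g; case: (phi g) => [r| |] //=.
    rewrite inver => _; have [->|r0] := eqVneq r 0; last by rewrite EFinM.
    by rewrite invr0 mulr0 mule_ge0 ?lee_fin ?sqr_ge0.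
  by rewrite invr0 mulr0 mule_ge0 ?lee_fin ?sqr_ge0// inve_ge0.
pose mu : {measure set (Omega R d) -> \bar R} := mdensity nu mphi phi0.
have muE A : measurable A -> mu A = (\int[nu]_(x in A) (w x)%:E)%E.
  move=> mA; apply: ae_eq_integral => //.
  - exact: measurable_funTS.
  - exact: measurable_funTS.
  by apply: filterS ae_phi_fin => g gfin _; rewrite /w fineK.
have dens (f : Omega R d -> R) : measurable_fun setT f -> (forall g, 0 <= f g) ->
    (\int[mu]_g (f g)%:E = \int[nu]_g (f g * w g)%:E)%E.
  move=> mf f0; rewrite (ge0_integral_density mw w0 muE) => [|| g].
  - by apply: eq_integral => g _; rewrite EFinM.
  - exact/measurable_EFinP.
  - by rewrite lee_fin.
have F0E (F : nat -> Omega R d -> R) : (forall n, cylZ (F n)) ->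
    'N[mu]_2%:E[EFin \o F n]%E @[n --> \oo] --> 0%E ->
    (\int[nu]_g (F n g ^+ 2 * w g)%:E)%E @[n --> \oo] --> 0%E.
  move=> ZF /Lnorm2_cvg0.
  under eq_fun => n.
    rewrite dens; [over|by apply: measurable_funX; exact: measurable_cylZ|].
    by move=> g; rewrite sqr_ge0.
  exact.
split.
- move=> F ZF /(F0E F ZF) F0 E0.
  have energy_dens G : cylZ G -> dform mu G G =
      (2^-1%:E * \int[nu]_g (energy G g * w g)%:E)%E.
    move=> ZG; rewrite /dform -dens//.
      exact: (measurable_cylZ (cylZ_energy ZG)).
    by move=> g; exact: energy_ge0.
  have dform0 G : (0 <= dform mu G G)%E.
    rewrite /dform mule_ge0 ?lee_fin ?invr_ge0//.
    by apply: integral_ge0 => g _; rewrite lee_fin; exact: Hdot_ge0.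
  apply: (proj2 (@ge0_cvge0P R nat \oo _ _ (fun n => dform0 (F n)))) => e e0.
  have half (x : \bar R) (a : R) : (2^-1%:E * x <= a%:E)%E = (x <= (2 * a)%:E)%E.
    by rewrite lee_pdivrMl// EFinM.
  have cE (a : R) : 0 < a -> exists N, forall p q, (N <= p)%N -> (N <= q)%N ->
      (\int[nu]_g (energy (F p \- F q) g * w g)%:E <= a%:E)%E.
    move=> a0; have a20 : 0 < a / 2 by rewrite divr_gt0.
    have := proj1 (@ge0_cvge0P R (nat * nat)%type (filter_prod \oo \oo) _ _
      (fun p => dform0 (F p.1 \- F p.2))) E0 _ a20.
    move=> [[A B] [[N1 _ AN1] [N2 _ BN2]] AB].
    exists (maxn N1 N2) => p q; rewrite !geq_max => /andP[p1 _] /andP[_ q2].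
    have := AB (p, q) (conj (AN1 _ p1) (BN2 _ q2)).
    rewrite /= energy_dens; last exact: (cylZB (ZF p) (ZF q)).
    by rewrite half mulrC divfK// pnatr_eq0.
  have e20 : 0 < 2 * e by rewrite mulr_gt0.
  have [N HN] := energy_closable wiener_nu mw w0 wpos iw idiv ZF F0 cE e20.
  exists N => // n Nn; change (dform mu (F n) (F n) <= e%:E)%E.
  by rewrite energy_dens// half; exact: (HN n Nn).
- move=> F u ZF [CMu Hu _] /(F0E F ZF) F0 /Lnorm2_cvg0 D0.
  have D0w : (\int[nu]_g (distance_sqr u (F n) g * w g)%:E)%E @[n --> \oo] --> 0%E.
    rewrite (_ : (fun n => _) =
        fun n => (\int[mu]_g (Hnorm (grad (F n) g - u g) ^+ 2)%:E)%E) //.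
    apply/funext => n; rewrite -dens.
    + by apply: eq_integral => g _; rewrite Hnorm_sqr.
    + exact: (measurable_distance_sqr CMu Hu (ZF n)).
    + by move=> g; exact: (distance_sqr_ge0 u (F n) g).
  have U0 := gradient_closable mw w0 CMu Hu wiener_nu wpos iw idiv ZF F0 D0w.
  apply: Lnorm2_eq0.
  rewrite -U0 -dens.
  + by apply: eq_integral => g _; rewrite Hnorm_sqr.
  + exact: (measurable_Hdot_self Hu).
  + by move=> g; exact: Hdot_ge0.
Qed.
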